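(* Let $M\in\mathbb{N}$, let $\Theta=\bigcup_{n\in\mathbb{N}}\mathbb{Z}^n$, let $(\Omega,\mathcal{F},\mathbb{P})$ be a probability space, let $\mathfrak{D}$ be a nonempty set, let $\delta_d,\mathfrak{R}_d\in[0,\infty)$, $d\in\mathfrak{D}$, and let $(\mathbb{X}_d,\mathcal{X}_d)$, $d\in\mathfrak{D}$, be nonempty Borel spaces. For every $d\in\mathfrak{D}$ let $g_d\colon\mathbb{X}_d\to\mathbb{R}$ and $G_d\colon\mathbb{X}_d\to\mathbb{R}$ be $\mathcal{X}_d/\mathcal{B}(\mathbb{R})$-measurable, let $(\mathcal{F}_d^\theta)_{\theta\in\Theta}$ be independent sub-$\sigma$-algebras of $\mathcal{F}$, and let $X_d^\theta=(X_d^{\theta,x}(\omega))_{x\in\mathbb{X}_d,\omega\in\Omega}\colon\mathbb{X}_d\times\Omega\to\mathbb{X}_d$, $\theta\in\Theta$, be i.i.d. random fields such that for all $\theta\in\Theta$, $X_d^\theta$ is $(\mathcal{X}_d\otimes\mathcal{F}_d^\theta)/\mathcal{X}_d$-measurable. Assume $\sup_{d\in\mathfrak{D}}\delta_d<1$, assume $$M>\frac{(1+3(\sup_{d\in\mathfrak{D}}\delta_d))^2}{(1-(\sup_{d\in\mathfrak{D}}\delta_d))^2},$$ and assume $\sup_{d\in\mathfrak{D}}\big(\sup_{x\in\mathbb{X}_d}(|g_d(x)|+|G_d(x)|)\big)<\infty$. For every $d\in\mathfrak{D}$ let $Q_{n,d}^\theta\colon\mathbb{X}_d\times\Omega\to\mathbb{R}$,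 $n\in\mathbb{N}_0$, $\theta\in\Theta$, satisfy for all $n\in\mathbb{N}_0$, $x\in\mathbb{X}_d$, $\theta\in\Theta$ that $$Q_{n,d}^\theta(x)=g_d(x)+\sum_{l=0}^{n-1}\frac{\delta_d}{M^{n-l}}\sum_{i=1}^{M^{n-l}}\Big[\max\big\{G_d(X_d^{(\theta,l,i),x}),Q_{l,d}^{(\theta,l,i)}(X_d^{(\theta,l,i),x})\big\}-\mathbf{1}_{\mathbb{N}}(l)\max\big\{G_d(X_d^{(\theta,l,i),x}),Q_{\max\{l-1,0\},d}^{(\theta,-l,i)}(X_d^{(\theta,l,i),x})\big\}\Big],$$ and let $\mathfrak{C}_{n,d}\in[0,\infty)$, $n\in\mathbb{N}_0$, $d\in\mathfrak{D}$, satisfy for all $n\in\mathbb{N}_0$, $d\in\mathfrak{D}$ that $$\mathfrak{C}_{n,d}\le\sum_{l=0}^{n-1}M^{n-l}\big(\mathfrak{R}_d+\mathfrak{C}_{l,d}+\mathbf{1}_{\mathbb{N}}(l)\mathfrak{C}_{\max\{l-1,0\},d}\big).$$ Then: (i) For every $d\in\mathfrak{D}$ there exists a unique function $Q_d\colon\mathbb{X}_d\to\mathbb{R}$ which is $\mathcal{X}_d/\mathcal{B}(\mathbb{R})$-measurable and satisfies for all $x\in\mathbb{X}_d$ that $\sup_{y\in\mathbb{X}_d}|Q_d(y)|<\infty$ and $$Q_d(x)=g_d(x)+\delta_d\,\mathbb{E}\big[\max\{G_d(X_d^{0,x}),Q_d(X_d^{0,x})\}\big].$$ (ii) There exist $N\colon(0,1]\to\mathbb{N}$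 and $c\in\mathbb{R}$ such that for all $d\in\mathfrak{D}$, $\varepsilon\in(0,1]$ it holds that $\mathfrak{C}_{N_\varepsilon,d}\le c\,\mathfrak{R}_d\,\varepsilon^{-c}$ and $$\sup_{x\in\mathbb{X}_d}\Big(\mathbb{E}\big[|Q_d(x)-Q_{N_\varepsilon,d}^0(x)|^2\big]\Big)^{1/2}\le\varepsilon.$$
   Context: $\mathbb{N}=\{1,2,3,\dots\}$, $\mathbb{N}_0=\mathbb{N}\cup\{0\}$; $\mathbf{1}_{\mathbb{N}}$ is the indicator function of $\mathbb{N}$. A Borel space is a measurable space that is measurably isomorphic to a Borel subset of $\mathbb{R}$ with its Borel $\sigma$-algebra (a standard Borel space). Indices in $\Theta$ are concatenated: for $\theta\in\mathbb{Z}^k$, $l,i\in\mathbb{Z}$, $(\theta,l,i)\in\mathbb{Z}^{k+2}\subseteq\Theta$; the index $0$ is $0\in\mathbb{Z}^1\subseteq\Theta$. The argument $\omega$ is suppressed: $Q_{l,d}^\eta(X_d^{\vartheta,x})$ denotes $\omega\mapsto Q_{l,d}^\eta(X_d^{\vartheta,x}(\omega),\omega)$. $N_\varepsilon$ denotes $N(\varepsilon)$. Empty sums are $0$. *)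

(* Defs.v *)
From HB Require Import structures.
From mathcomp Require Import all_boot all_order all_algebra.
From mathcomp Require Import all_classical all_reals all_analysis.

Set Implicit Arguments.
Unset Strict Implicit.
Unset Printing Implicit Defensive.

Import Order.TTheory GRing.Theory Num.Theory.
Import numFieldNormedType.Exports.

Local Open Scope classical_set_scope.
Local Open Scope ring_scope.

(* The union over n >= 1 of Z^n: an element of Z^n is a sequence of n integers. *)
Definition Theta := {s : seq int | (0 < size s)%N}.

Lemma theta_ext_subproof (theta : Theta) (l i : int) :
  (0 < size (val theta ++ [:: l; i]))%N.
Proof. by rewrite size_cat addn2. Qed.

Definition theta_ext (theta : Theta) (l i : int) : Theta :=
  exist _ (val theta ++ [:: l; i]) (theta_ext_subproof theta l i).

Definition theta0 : Theta := exist _ [:: 0] isT.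

(* f and g are mutually inverse measurable maps between T and the Borel set B;
   the values of g outside B are irrelevant. Every measurableType is pointed,
   so that T is nonempty. *)
Definition borel_space (R : realType) (d : measure_display)
    (T : measurableType d) : Prop :=
  exists (B : set R) (f : T -> R) (g : R -> T),
    [/\ measurable B,
        measurable_fun [set: T] f /\ measurable_fun B g,
        forall x, B (f x),
        cancel f g
      & forall y, B y -> f (g y) = y].

Definition sub_sigma_algebra_of (d : measure_display) (T : measurableType d)
    (F : set (set T)) : Prop :=
  sigma_algebra [set: T] F /\ F `<=` measurable.

Definition independent_systems (R : realType) (d : measure_display)
    (T : measurableType d) (P : probability T R) (I : choiceType)
    (F : I -> set (set T)) : Prop :=
  forall (J : seq I) (A : I -> set T), uniq J ->
    (forall i, i \in J -> F i (A i)) ->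
    P (\bigcap_(i in [set` J]) A i) = (\prod_(i <- J) P (A i))%E.

(* The product sigma-algebra on the path space S -> E. *)
Definition path_sigma_algebra (S : Type) (d : measure_display)
    (E : measurableType d) : set (set (S -> E)) :=
  <<s [set C | exists (x : S) (B : set E),
         measurable B /\ C = [set f : S -> E | B (f x)]] >>.

(* The family of random fields is independent if the sigma-algebras that the
   paths w |-> (x |-> Y i x w) generate are independent, and identically
   distributed if all paths have the same law on the product sigma-algebra. *)
Definition iid_random_fields (R : realType) (d : measure_display)
    (T : measurableType d) (P : probability T R) (I : choiceType) (S : Type)
    (dE : measure_display) (E : measurableType dE) (Y : I -> S -> T -> E) : Prop :=
  [/\ forall i x, measurable_fun [set: T] (Y i x),
      independent_systems P (fun i =>
        preimage_set_system [set: T] (fun w x => Y i x w)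
          (@path_sigma_algebra S dE E))
    & forall i j (A : set (S -> E)), path_sigma_algebra A ->
        P [set w | A (fun x => Y i x w)] = P [set w | A (fun x => Y j x w)]].

(* Measurability with respect to the product of the sigma-algebra of E and F:
   when F is a sigma-algebra, g_sigma_algebraType F is T equipped with F. *)
Definition jointly_measurable (dE d : measure_display) (E : measurableType dE)
    (T : measurableType d) (F : set (set T)) (Y : E -> T -> E) : Prop :=
  measurable_fun [set: E * g_sigma_algebraType F]
    (fun p : E * g_sigma_algebraType F => Y p.1 p.2).

(* Both sides of the fixed-point equation are extended reals: the library's
   expectation takes values in \bar R. *)
Definition bounded_solution (R : realType) (d : measure_display)
    (T : measurableType d) (P : probability T R) (dE : measure_display)
    (E : measurableType dE) (delta : R) (g G : E -> R) (Y : E -> T -> E)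
    (q : E -> R) : Prop :=
  measurable_fun [set: E] q /\
  forall x : E,
    (ereal_sup (range (fun y => `|q y|%:E)) < +oo)%E /\
    (q x)%:E =
      ((g x)%:E + delta%:E * 'E_P[fun w => Num.max (G (Y x w)) (q (Y x w))])%E.

(* Main.v *)
Require Import Defs.
From HB Require Import structures.
From mathcomp Require Import all_boot all_order all_algebra.
From mathcomp Require Import all_classical all_reals all_analysis.
From mathcomp Require Import measurable_realfun zify ring lra.

Set Implicit Arguments.
Unset Strict Implicit.
Unset Printing Implicit Defensive.

Import Order.TTheory GRing.Theory Num.Theory.
Import numFieldNormedType.Exports.

Local Open Scope classical_set_scope.
Local Open Scope ring_scope.

(** The functional equation is the fixed-point equation of the operator
    [q |-> g + delta E[max (G X) (q X)]] ([bellman]), which contracts the sup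
    norm by the factor [delta < 1]. Existence comes from a monotone Picard
    iteration ([bellman_fixed_exists]), uniqueness from the contraction
    ([bellman_fixed_unique]).

    For the approximation rate, fix the problem, let [s] be the supremum of the
    [delta]'s and let [u n] bound the L2 distance between [Q n] and the fixed
    point [q], uniformly in the starting point and in the index [theta].
    The L2 error of [Q n.+1] splits into a mean and a fluctuation.

    - Mean. The samples of level [l] have mean [value l - value l.-1]
      ([mean_sample]), so the sum over the levels telescopes to [value n], and
      the bias is at most [delta * u n]. The cancellation needs that the law of
      [Q l theta x] does not depend on [theta] ([scheme_law]).
    - Fluctuation. The samples of one level are independent, so averaging
      [M ^ (n.+1 - l)] of them multiplies the L2 norm by [a ^ (n.+1 - l)] with
      [a = 1 / sqrt M] ([mean_sqr_fluctuation]); the L2 norm of one sample is at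
      most [u l + u l.-1], or the sup bound of [g] and [G] when [l = 0].

    Altogether ([error_step])
    [u n.+1 <= s (u n + \sum_(l <= n) a ^ (n.+1 - l) (u l + u l.-1))], and
    a geometric sequence of ratio [kappa < 1] solves this recursion as soon as
    [s (1 + a) <= kappa - a] ([geometric_recursion]). Such a [kappa] exists
    because the assumption on [M] gives [a (1 + 3 s) < 1 - s], hence
    [s + a + s a < 1] ([rate_exists]). The error thus decays geometrically
    while the cost grows at most like [(4 M) ^ n] ([cost_bound]), and a level of
    order [ln (1 / eps)] yields the claim ([level_selection]).

    Independence is used only through freezing ([mean_freeze],
    [mean_freeze_field]): a random field carried by one block of the
    sigma-algebras, evaluated at a random point carried by a disjoint block, has
    the mean obtained by averaging first over the field, with the point frozen,
    and then over the point. Every random variable is bounded,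
    with the deterministic bound [B * 3 ^ n] at level [n], so that
    integrability is never an issue. *)

(** * Bounded measurable functions and their means *)

Definition bounded_measurable (R : realType) (d : measure_display)
    (T : measurableType d) (f : T -> R) : Prop :=
  measurable_fun [set: T] f /\ exists B : R, forall x, `|f x| <= B.

Section bounded_measurable_lemmas.
Context (R : realType) (d : measure_display) (T : measurableType d).
Implicit Types f g : T -> R.

Lemma bounded_measurable_cst (c : R) :
  bounded_measurable (fun _ : T => c).
Proof. by split; [exact: measurable_cst|exists `|c|]. Qed.

Lemma bounded_measurableD f g : bounded_measurable f ->
  bounded_measurable g -> bounded_measurable (fun x => f x + g x).
Proof.
move=> [mf [B fB]] [mg [C gC]]; split; first exact: measurable_funD.
by exists (B + C) => x; rewrite (le_trans (ler_normD _ _))// lerD.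
Qed.

Lemma bounded_measurableM f g : bounded_measurable f ->
  bounded_measurable g -> bounded_measurable (fun x => f x * g x).
Proof.
move=> [mf [B fB]] [mg [C gC]]; split; first exact: measurable_funM.
by exists (B * C) => x; rewrite normrM ler_pM.
Qed.

Lemma bounded_measurableZ (c : R) f : bounded_measurable f ->
  bounded_measurable (fun x => c * f x).
Proof. exact/bounded_measurableM/bounded_measurable_cst. Qed.

Lemma bounded_measurableB f g : bounded_measurable f ->
  bounded_measurable g -> bounded_measurable (fun x => f x - g x).
Proof.
move=> [mf [B fB]] [mg [C gC]]; split; first exact: measurable_funB.
by exists (B + C) => x; rewrite (le_trans (ler_normB _ _))// lerD.
Qed.

Lemma bounded_measurable_sqr f : bounded_measurable f ->
  bounded_measurable (fun x => f x ^+ 2).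
Proof.
move=> bf; under eq_fun do rewrite expr2.
exact: bounded_measurableM.
Qed.

Lemma bounded_measurable_norm f : bounded_measurable f ->
  bounded_measurable (fun x => `|f x|).
Proof.
move=> [mf [B fB]]; split; first exact: measurableT_comp.
by exists B => x; rewrite normr_id.
Qed.

Lemma ler_norm_max (a b c : R) : `|a| <= c -> `|b| <= c -> `|Num.max a b| <= c.
Proof. by move=> ac bc; case: (leP a b). Qed.

Lemma bounded_measurable_max f g : bounded_measurable f ->
  bounded_measurable g -> bounded_measurable (fun x => Num.max (f x) (g x)).
Proof.
move=> [mf [B fB]] [mg [C gC]]; split; first exact: measurable_maxr.
exists (Num.max B C) => x.
by apply: ler_norm_max; rewrite le_max ?fB ?gC ?orbT.
Qed.

Lemma bounded_measurable_sum (I : Type) (r : seq I) (f : I -> T -> R) :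
  (forall i, bounded_measurable (f i)) ->
  bounded_measurable (fun x => \sum_(i <- r) f i x).
Proof.
move=> bf; elim: r => [|i r IH].
  by under eq_fun do rewrite big_nil; exact: bounded_measurable_cst.
by under eq_fun do rewrite big_cons; exact: bounded_measurableD.
Qed.

End bounded_measurable_lemmas.

Lemma max_dist (R : realType) (c a b : R) : `|Num.max c a - Num.max c b| <= `|a - b|.
Proof.
have ab := ler_norm (a - b); have := ler_norm (b - a); rewrite distrC => ba.
rewrite ler_norml; apply/andP; split.
  by case: (leP c a); case: (leP c b); lra.
by case: (leP c a); case: (leP c b); lra.
Qed.

(** A bounded function that is the identity on [[-D, D]]: composing with it
    turns identities for bounded test functions into identities for bounded
    random variables. *)
Definition clamp (R : realType) (D x : R) : R := Num.max (- D) (Num.min x D).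

Lemma clampE (R : realType) (D x : R) : `|x| <= D -> clamp D x = x.
Proof. by rewrite ler_norml /clamp => /andP[Dx xD]; rewrite min_l// max_r. Qed.

Lemma bounded_measurable_clamp (R : realType) (D : R) :
  0 <= D -> bounded_measurable (clamp D).
Proof.
move=> D0; split; first by apply: measurable_maxr => //; exact: measurable_minr.
exists D => x; rewrite ler_norml /clamp le_max lexx/= ge_max ge_min lexx orbT.
by rewrite andbT (le_trans _ D0)// oppr_le0.
Qed.

Lemma bounded_measurable_comp (R : realType) (d d' : measure_display)
    (T : measurableType d) (T' : measurableType d') (f : T' -> R) (u : T -> T') :
  bounded_measurable f -> measurable_fun [set: T] u ->
  bounded_measurable (fun x => f (u x)).
Proof.
move=> [mf [B fB]] mu; split; first exact: (measurableT_comp mf mu).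
by exists B => x.
Qed.

Section mean.
Context (R : realType) (d : measure_display) (T : measurableType d).
Variable P : probability T R.
Implicit Types f g : T -> R.

Definition mean f : R := \int[P]_w f w.

Lemma bounded_integrable f : bounded_measurable f ->
  P.-integrable [set: T] (EFin \o f).
Proof.
move=> [mf [B fB]]; apply: measurable_bounded_integrable => //.
  by apply: le_lt_trans (ltry 1); exact: probability_le1.
exists `|B|; split; first exact: num_real.
move=> x Bx y _ /=; rewrite (le_trans (fB y))// (le_trans (ler_norm B))//.
exact: ltW.
Qed.

Lemma mean_fin f : bounded_measurable f -> 'E_P[f]%E = (mean f)%:E.
Proof.
by move=> bf; rewrite unlock /mean /Rintegral fineK//;
  apply: integrable_fin_num => //; exact: bounded_integrable.
Qed.

Lemma mean_cst (c : R) : mean (fun=> c) = c.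
Proof.
rewrite /mean Rintegral_cst// [X in fine X](_ : _ = 1%E) ?mulr1//.
exact: probability_setT.
Qed.

Lemma meanD f g : bounded_measurable f -> bounded_measurable g ->
  mean (fun w => f w + g w) = mean f + mean g.
Proof. by move=> bf bg; apply: RintegralD => //; exact: bounded_integrable. Qed.

Lemma meanB f g : bounded_measurable f -> bounded_measurable g ->
  mean (fun w => f w - g w) = mean f - mean g.
Proof. by move=> bf bg; apply: RintegralB => //; exact: bounded_integrable. Qed.

Lemma meanZ (c : R) f : bounded_measurable f ->
  mean (fun w => c * f w) = c * mean f.
Proof. by move=> bf; apply: RintegralZl => //; exact: bounded_integrable. Qed.

Lemma mean_le f g : bounded_measurable f -> bounded_measurable g ->
  (forall w, f w <= g w) -> mean f <= mean g.
Proof.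
by move=> bf bg fg; apply: le_Rintegral => //; exact: bounded_integrable.
Qed.

Lemma mean_le_cst f (c : R) : bounded_measurable f ->
  (forall w, f w <= c) -> mean f <= c.
Proof.
move=> bf fc; rewrite -[leRHS](mean_cst c).
by apply: mean_le => //; exact: bounded_measurable_cst.
Qed.

Lemma mean_ge0 f : (forall w, 0 <= f w) -> 0 <= mean f.
Proof. by move=> f0; apply: Rintegral_ge0. Qed.

Lemma norm_mean_le f : bounded_measurable f ->
  `|mean f| <= mean (fun w => `|f w|).
Proof. by move=> bf; apply: le_normr_Rintegral => //; exact: bounded_integrable. Qed.

Lemma norm_mean_le_cst f (c : R) : bounded_measurable f ->
  (forall w, `|f w| <= c) -> `|mean f| <= c.
Proof.
move=> bf fc; rewrite (le_trans (norm_mean_le bf))//.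
by apply: mean_le_cst => //; exact: bounded_measurable_norm.
Qed.

(** The quadratic form [s, t |-> E[(s f + t g)^2]] is nonnegative. *)
Lemma mean_cauchy_schwarz f g : bounded_measurable f -> bounded_measurable g ->
  mean (fun w => f w * g w) ^+ 2
    <= mean (fun w => f w ^+ 2) * mean (fun w => g w ^+ 2).
Proof.
move=> bf bg.
set r := mean (fun w => f w * g w); set p := mean _; set q := mean (fun w => g w ^+ 2).
have bfg := bounded_measurableM bf bg.
have bf2 := bounded_measurable_sqr bf; have bg2 := bounded_measurable_sqr bg.
have quad (s t : R) : 0 <= s ^+ 2 * p + 2 * s * t * r + t ^+ 2 * q.
  rewrite -!meanZ// -meanD; do 1?exact: bounded_measurableZ.
  rewrite -meanD; last 2 first.
  - by apply: bounded_measurableD; exact: bounded_measurableZ.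
  - exact: bounded_measurableZ.
  apply: mean_ge0 => w.
  rewrite (_ : _ + _ = (s * f w + t * g w) ^+ 2) ?sqr_ge0//; ring.
have q0 : 0 <= q by apply: mean_ge0 => w; exact: sqr_ge0.
have [q_eq0|q_neq0] := eqVneq q 0.
  have [->|r0] := eqVneq r 0; first by rewrite expr0n/= q_eq0 mulr0.
  (* at this point the quadratic form would be equal to -1 *)
  have := quad 1 (- (p + 1) / (2 * r)).
  rewrite q_eq0 (_ : _ + _ = -1)//; last by field.
  by rewrite oppr_ge0 ler10.
have qp : 0 < q by rewrite lt_def q_neq0.
have := quad q (- r); rewrite (_ : _ + _ = q * (p * q - r ^+ 2)); last ring.
by rewrite pmulr_rge0// subr_ge0.
Qed.

(** The triangle inequality in L2, in the form suited to a recursion on error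
    bounds: the squared norms are bounded by squares. *)
Lemma mean_sqrD_le f g (a b : R) : bounded_measurable f ->
    bounded_measurable g -> 0 <= a -> 0 <= b ->
    mean (fun w => f w ^+ 2) <= a ^+ 2 -> mean (fun w => g w ^+ 2) <= b ^+ 2 ->
  mean (fun w => (f w + g w) ^+ 2) <= (a + b) ^+ 2.
Proof.
move=> bf bg a0 b0 fa gb.
have bfg := bounded_measurableM bf bg.
have bf2 := bounded_measurable_sqr bf; have bg2 := bounded_measurable_sqr bg.
have rab : mean (fun w => f w * g w) <= a * b.
  rewrite (le_trans (ler_norm _))// -(@ler_pXn2r _ 2) ?nnegrE ?mulr_ge0//.
  rewrite real_normK ?num_real// (le_trans (mean_cauchy_schwarz bf bg))//.
  by rewrite exprMn ler_pM//; apply: mean_ge0 => w; exact: sqr_ge0.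
rewrite (_ : (fun w => _) =
    fun w => f w ^+ 2 + 2 * (f w * g w) + g w ^+ 2); last first.
  by apply/funext => w; ring.
rewrite meanD//; last by apply: bounded_measurableD => //; exact: bounded_measurableZ.
rewrite meanD ?meanZ//; last exact: bounded_measurableZ.
rewrite (_ : (a + b) ^+ 2 = a ^+ 2 + 2 * (a * b) + b ^+ 2); last ring.
by rewrite !lerD// ler_pM2l.
Qed.

Lemma mean_sqr_sum_le (I : eqType) (r : seq I) (f : I -> T -> R) (a : I -> R) :
    (forall i, bounded_measurable (f i)) -> (forall i, 0 <= a i) ->
    (forall i, i \in r -> mean (fun w => f i w ^+ 2) <= a i ^+ 2) ->
  mean (fun w => (\sum_(i <- r) f i w) ^+ 2) <= (\sum_(i <- r) a i) ^+ 2.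
Proof.
move=> bf a0; elim: r => [_|i r IH fa].
  by under eq_fun do rewrite big_nil; rewrite big_nil expr0n mean_cst.
under eq_fun do rewrite big_cons.
rewrite big_cons; apply: mean_sqrD_le => //.
- exact: bounded_measurable_sum.
- exact: sumr_ge0.
- by apply: fa; exact: mem_head.
- by apply: IH => j jr; apply: fa; rewrite inE jr orbT.
Qed.

Lemma mean_norm_le f (a : R) : bounded_measurable f -> 0 <= a ->
  mean (fun w => f w ^+ 2) <= a ^+ 2 -> mean (fun w => `|f w|) <= a.
Proof.
move=> bf a0 fa; have bn := bounded_measurable_norm bf.
have := mean_cauchy_schwarz bn (bounded_measurable_cst _ (1 : R)).
under [X in mean X]eq_fun do rewrite mulr1.
under [X in _ <= mean X * _]eq_fun do rewrite real_normK ?num_real//.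
under [X in _ <= _ * mean X]eq_fun do rewrite expr1n.
rewrite mean_cst mulr1 => h.
rewrite -(@ler_pXn2r _ 2) ?nnegrE//; last by apply: mean_ge0.
exact: le_trans h fa.
Qed.

End mean.

(** * Freezing an independent variable *)

Section independence_fubini.
Context (R : realType) (d d1 d2 : measure_display) (T : measurableType d).
Context (T1 : measurableType d1) (T2 : measurableType d2).
Variables (P : probability T R) (V : T -> T2).
Hypothesis mV : measurable_fun [set: T] V.
Variable f : T1 * T2 -> R.
Hypothesis bf : bounded_measurable f.

Let V' : {mfun T >-> T2} :=
  HB.pack_for {mfun T >-> T2} V (isMeasurableFun.Build _ _ _ _ _ mV).

Let F (y : T1) : \bar R := (\int[distribution P V']_v (f (y, v))%:E)%E.

Let FE y : F y = (mean P (fun w => f (y, V w)))%:E.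
Proof.
have bfy : bounded_measurable (fun w => f (y, V w)).
  by apply: (bounded_measurable_comp bf); exact: measurable_fun_pair.
rewrite /F integral_distribution/=.
- by rewrite -mean_fin// unlock.
- apply/measurable_EFinP; exact: measurableT_comp bf.1 (pair1_measurable _).
- exact: bounded_integrable.
Qed.

Let int_prod (mu : probability T1 R) :
  (mu \x distribution P V')%E.-integrable setT (EFin \o f).
Proof.
apply: measurable_bounded_integrable => //.
- rewrite -setXTT [ltLHS]product_measure1E//.
  by apply: le_lt_trans (ltry 1); rewrite -[leRHS]mule1 lee_pmul//;
    exact: probability_le1.
- exact: bf.1.
- case: bf => _ [B fB]; exists `|B|; split; first exact: num_real.
  move=> x Bx y _ /=; rewrite (le_trans (fB y))// (le_trans (ler_norm B))//.
  exact: ltW.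
Qed.

(** Measurability of a parametrised mean is part of Fubini's theorem; that
    theorem asks for a measure on the parameter space, and any one will do. *)
Lemma bounded_measurable_mean :
  bounded_measurable (fun y => mean P (fun w => f (y, V w))).
Proof.
split.
  apply/measurable_EFinP.
  rewrite (_ : EFin \o _ = F); first exact: measurable_fubini_F (int_prod (dirac point)).
  by apply/funext => y; rewrite FE.
case: bf => _ [B fB]; exists B => y; apply: norm_mean_le_cst => //.
by apply: (bounded_measurable_comp bf); exact: measurable_fun_pair.
Qed.

Variable U : T -> T1.
Hypothesis mU : measurable_fun [set: T] U.

Let U' : {mfun T >-> T1} :=
  HB.pack_for {mfun T >-> T1} U (isMeasurableFun.Build _ _ _ _ _ mU).

Let mUV : measurable_fun [set: T] (fun w => (U w, V w)).
Proof. exact: measurable_fun_pair. Qed.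

Let UV : {mfun T >-> (T1 * T2)%type} :=
  HB.pack_for {mfun T >-> (T1 * T2)%type} (fun w => (U w, V w))
    (isMeasurableFun.Build _ _ _ _ _ mUV).

(** The law of a pair of independent variables is the product of their laws,
    so that Fubini's theorem separates the two sources of randomness. *)
Lemma mean_freeze :
    (forall A B, measurable A -> measurable B ->
      P (U @^-1` A `&` V @^-1` B) = (P (U @^-1` A) * P (V @^-1` B))%E) ->
  mean P (fun w => f (U w, V w)) =
    mean P (fun w' => mean P (fun w => f (U w', V w))).
Proof.
move=> ind; apply: EFin_inj.
have bfUV : bounded_measurable (fun w => f (U w, V w)).
  by apply: (bounded_measurable_comp bf); exact: mUV.
have bm := bounded_measurable_mean.
have bmU := bounded_measurable_comp bm mU.
rewrite -mean_fin// -mean_fin// !unlock.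
transitivity (\int[distribution P UV]_z (f z)%:E)%E.
  rewrite integral_distribution//; last exact: bounded_integrable.
  by apply/measurable_EFinP; exact: bf.1.
transitivity (\int[distribution P U' \x distribution P V']_z (f z)%:E)%E.
  apply: eq_measure_integral => A mA _; apply/esym.
  by apply: product_measure_unique => // B C mB mC; exact: ind.
rewrite -(integral12_prod_meas1 (int_prod (distribution P U'))).
transitivity (\int[distribution P U']_x
   (mean P (fun w => f (x, V w)))%:E)%E.
  by apply: eq_integral => x _; exact: FE.
rewrite integral_distribution//; last exact: bounded_integrable bmU.
by apply/measurable_EFinP; exact: bm.1.
Qed.

End independence_fubini.

(** * Independent blocks of sigma-algebras *)

(** Both sides are finite measures in [A], and they agree on a pi-system. *)
Lemma independent_pi_system (R : realType) (d : measure_display)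
    (T : measurableType d) (P : probability T R) (G : set (set T)) (B : set T) :
    G `<=` measurable -> G setT -> setI_closed G -> measurable B ->
    (forall A, G A -> P (A `&` B) = (P A * P B)%E) ->
  forall A, <<s G >> A -> P (A `&` B) = (P A * P B)%E.
Proof.
move=> Gm GT GI mB GP A sGA.
have PB : P B \is a fin_num by exact: fin_num_measure.
have PB0 : 0 <= fine (P B) by exact: fine_ge0.
rewrite -(fineK PB) muleC.
apply: (@g_sigma_algebra_measure_unique _ _ _ G Gm (fun=> setT) _ _
  (mrestr P mB) (mscale (NngNum PB0) P)) => //.
- by rewrite bigcup_const//; exists 0%N.
- move=> C GC; transitivity (P C * P B)%E; first exact: GP.
  by rewrite muleC -[in LHS](fineK PB).
- move=> _; rewrite /mrestr; apply: le_lt_trans (ltry 1).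
  by apply: probability_le1; exact: measurableI.
Qed.

(** Only a generating family: the sigma-algebra of the block is [<<s block F S >>]. *)
Definition block (I : Type) (Omega : Type) (F : I -> set (set Omega)) (S : set I)
    : set (set Omega) :=
  \bigcup_(t in S) F t.

Section block_independence.
Context (R : realType) (d : measure_display) (Omega : measurableType d).
Variables (P : probability Omega R) (I : choiceType) (F : I -> set (set Omega)).
Hypothesis F_sub : forall t, sub_sigma_algebra_of (F t).
Hypothesis F_indep : independent_systems P F.
Implicit Types S : set I.

Let F_setT t : F t setT.
Proof.
by have [[F0 FC _] _] := F_sub t; rewrite -setC0 -setTD; exact: FC.
Qed.

Let F_setI t A B : F t A -> F t B -> F t (A `&` B).
Proof.
have [Fs Fm] := F_sub t => FA FB.
have : <<s F t >> (A `&` B).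
  apply: (@measurableI _ (g_sigma_algebraType (F t))).
  - exact: sub_sigma_algebra.
  - exact: sub_sigma_algebra.
by rewrite sigma_algebra_id.
Qed.

Let cyl S : set (set Omega) := [set B | exists (J : seq I) (A : I -> set Omega),
  [/\ uniq J, forall i, F i (A i), forall i, i \in J -> S i &
      B = \bigcap_(i in [set` J]) A i]].

Let cyl_measurable S : cyl S `<=` measurable.
Proof.
move=> _ [J [A [_ FA _ ->]]]; rewrite bigcap_seq.
by apply: bigsetI_measurable => i _; have [_] := F_sub i; exact.
Qed.

Let cylT S : cyl S setT.
Proof.
exists [::], (fun=> setT); split => //.
by apply/seteqP; split => // w _ i.
Qed.

Let cylI S : setI_closed (cyl S).
Proof.
move=> _ _ [J [A [_ FA JS ->]]] [J' [A' [_ FA' JS' ->]]].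
(* An index that occurs in both families carries the intersection of its two
   events. *)
exists (undup (J ++ J')), (fun i => (if i \in J then A i else setT)
  `&` (if i \in J' then A' i else setT)); split.
- exact: undup_uniq.
- by move=> i; apply: F_setI; case: ifP => _; rewrite ?FA ?FA'//; exact: F_setT.
- by move=> i; rewrite mem_undup mem_cat => /orP[/JS|/JS'].
- apply/seteqP; split => w /=.
    move=> [wA wA'] i _; split.
    + by case: ifPn => // iJ; exact: wA.
    + by case: ifPn => // iJ; exact: wA'.
  move=> wAA'; split => i /= iJ.
  + have /wAA'[] : [set` undup (J ++ J')] i.
      by rewrite /= mem_undup mem_cat iJ.
    by rewrite iJ.
  + have /wAA'[_] : [set` undup (J ++ J')] i.
      by rewrite /= mem_undup mem_cat iJ orbT.
    by rewrite iJ.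
Qed.

Let block_cyl S : <<s block F S >> `<=` <<s cyl S >>.
Proof.
apply: sub_sigma_algebra2 => A [t St FA].
exists [:: t], (fun i => if i == t then A else setT); split => //.
- by move=> i; case: eqP => [->|].
- by move=> i; rewrite inE => /eqP ->.
- apply/seteqP; split => [w Aw i|w /(_ t)] /=.
    by rewrite inE => ->.
  by rewrite eqxx; apply; rewrite /= mem_head.
Qed.

Lemma block_measurable S : <<s block F S >> `<=` measurable.
Proof.
apply: smallest_sub; first exact: sigma_algebra_measurable.
by move=> A [t _ FA]; have [_] := F_sub t; exact.
Qed.

Let cyl_indep S S' A B : [disjoint S & S'] ->
  cyl S A -> cyl S' B -> P (A `&` B) = (P A * P B)%E.
Proof.
move=> SS' [J [A1 [uJ FA JS ->]]] [J' [A2 [uJ' FA' JS' ->]]].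
have JJ' i : i \in J' -> i \in J = false.
  move=> iJ'; apply/negP => /JS Si; move/disj_setPS : SS' => /(_ i); apply.
  by split => //; exact: JS'.
pose A3 i := if i \in J then A1 i else A2 i.
have E1 : \bigcap_(i in [set` J]) A1 i = \bigcap_(i in [set` J]) A3 i.
  by apply: eq_bigcapr => i /= iJ; rewrite /A3 iJ.
have E2 : \bigcap_(i in [set` J']) A2 i = \bigcap_(i in [set` J']) A3 i.
  by apply: eq_bigcapr => i /= iJ; rewrite /A3 JJ'.
have F3 i : F i (A3 i) by rewrite /A3; case: ifP.
rewrite E1 E2 -bigcap_setU.
rewrite (_ : [set` J] `|` [set` J'] = [set` J ++ J']); last first.
  apply/seteqP; split => i /=; first by rewrite mem_cat => -[->|->//]; rewrite ?orbT.
  by rewrite mem_cat => /orP.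
rewrite F_indep//; last first.
  rewrite cat_uniq uJ uJ' andbT/=; apply/hasPn => i iJ'.
  by rewrite /= JJ'.
by rewrite big_cat/= !F_indep.
Qed.

(** Disjoint blocks of independent sigma-algebras generate independent
    sigma-algebras: finite intersections of events taken from one block form a
    pi-system, on which independence is the hypothesis. *)
Lemma block_independent S S' A B : [disjoint S & S'] ->
  <<s block F S >> A -> <<s block F S' >> B -> P (A `&` B) = (P A * P B)%E.
Proof.
move=> SS' /block_cyl sA /block_cyl sB.
have cylm S0 : <<s cyl S0 >> `<=` measurable.
  by apply: smallest_sub => //; exact: sigma_algebra_measurable.
apply: (independent_pi_system (@cyl_measurable S) (cylT S)
  (@cylI S) (cylm _ _ sB)) => //.
move=> C cC; rewrite setIC muleC.
apply: (independent_pi_system (@cyl_measurable S') (cylT S')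
  (@cylI S') (cyl_measurable cC)) => //.
by move=> D cD; rewrite setIC muleC; exact: (@cyl_indep S S').
Qed.

End block_independence.

(** * Random variables carried by a block *)

Notation block_space F S := (g_sigma_algebraType (block F S)).

Definition adapted (I : Type) (d : measure_display) (Omega : measurableType d)
    (F : I -> set (set Omega)) (S : set I) (d1 : measure_display)
    (T1 : measurableType d1) (f : Omega -> T1) : Prop :=
  measurable_fun [set: block_space F S] (f : block_space F S -> T1).

(** Laws are compared through bounded test functions, since these are what
    freezing applies to. *)
Definition same_law (R : realType) (d d1 : measure_display)
    (Omega : measurableType d) (P : probability Omega R)
    (T1 : measurableType d1) (f f' : Omega -> T1) : Prop :=
  forall phi : T1 -> R, bounded_measurable phi ->
    mean P (fun w => phi (f w)) = mean P (fun w => phi (f' w)).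

Section adapted_block.
Context (R : realType) (d : measure_display) (Omega : measurableType d).
Variables (P : probability Omega R) (I : choiceType) (F : I -> set (set Omega)).
Hypothesis F_sub : forall t, sub_sigma_algebra_of (F t).
Hypothesis F_indep : independent_systems P F.
Implicit Types S : set I.

Lemma block_space_incl S S' : S `<=` S' ->
  measurable_fun [set: block_space F S'] (id : block_space F S' -> block_space F S).
Proof.
move=> SS' _ A mA; rewrite setTI preimage_id.
by apply: sub_sigma_algebra2 mA; exact: bigcup_subset.
Qed.

Lemma block_space_id S :
  measurable_fun [set: Omega] (id : Omega -> block_space F S).
Proof.
by move=> _ A mA; rewrite setTI preimage_id; exact: (block_measurable F_sub mA).
Qed.

Lemma adapted_sub S S' (d1 : measure_display) (T1 : measurableType d1)
    (f : Omega -> T1) : S `<=` S' -> adapted F S f -> adapted F S' f.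
Proof. by move=> SS' af; exact: (measurableT_comp af (block_space_incl SS')). Qed.

Lemma adapted_measurable S (d1 : measure_display) (T1 : measurableType d1)
    (f : Omega -> T1) : adapted F S f -> measurable_fun [set: Omega] f.
Proof. by move=> af; exact: (measurableT_comp af (@block_space_id S)). Qed.

Lemma adapted_comp S (d1 d2 : measure_display) (T1 : measurableType d1)
    (T2 : measurableType d2) (f : Omega -> T1) (h : T1 -> T2) :
  measurable_fun [set: T1] h -> adapted F S f -> adapted F S (fun w => h (f w)).
Proof. by move=> mh af; exact: (measurableT_comp mh af). Qed.

Lemma adapted_section S (d1 : measure_display) (T1 : measurableType d1)
    (f : T1 -> Omega -> R) (x : T1) :
  measurable_fun [set: T1 * block_space F S] (fun p => f p.1 p.2) ->
  adapted F S (f x).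
Proof. by move=> mf; exact: (measurableT_comp mf (pair1_measurable x)). Qed.

Lemma adapted_sum (K : choiceType) (J : seq K) (S : K -> set I)
    (Z : K -> Omega -> R) : (forall k, adapted F (S k) (Z k)) ->
  adapted F (\bigcup_(k in [set` J]) S k) (fun w => \sum_(k <- J) Z k w).
Proof.
move=> aZ; elim: J => [|k J IH].
  rewrite (_ : (fun w => _) = fun=> 0); last by apply/funext => w; rewrite big_nil.
  exact: measurable_cst.
rewrite (_ : (fun w => _) = fun w => Z k w + \sum_(j <- J) Z j w); last first.
  by apply/funext => w; rewrite big_cons.
apply: measurable_funD.
- apply: adapted_sub (aZ k) => t St; exists k => //=; exact: mem_head.
- by apply: adapted_sub IH => t [j jJ St]; exists j => //=;
    rewrite inE; apply/orP; right.
Qed.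

Lemma adapted_independent S S' (d1 d2 : measure_display)
    (T1 : measurableType d1) (T2 : measurableType d2)
    (U : Omega -> T1) (V : Omega -> T2) :
  [disjoint S & S'] -> adapted F S U -> adapted F S' V ->
  forall A B, measurable A -> measurable B ->
    P (U @^-1` A `&` V @^-1` B) = (P (U @^-1` A) * P (V @^-1` B))%E.
Proof.
move=> SS' aU aV A B mA mB.
apply: (block_independent F_sub F_indep SS').
- by rewrite -[X in <<s _ >> X]setTI; exact: aU.
- by rewrite -[X in <<s _ >> X]setTI; exact: aV.
Qed.

(** The form of freezing that suits random fields: [f] is a field whose
    randomness comes from the block [S'] alone, evaluated at a random point
    [U] that depends on a disjoint block. *)
Lemma mean_freeze_field S S' (d1 : measure_display) (T1 : measurableType d1)
    (U : Omega -> T1) (f : T1 -> Omega -> R) :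
  [disjoint S & S'] -> adapted F S U ->
  bounded_measurable (fun p : T1 * block_space F S' => f p.1 p.2) ->
  mean P (fun w => f (U w) w) = mean P (fun w' => mean P (fun w => f (U w') w)).
Proof.
move=> SS' aU bf.
apply: (mean_freeze (P := P) (@block_space_id S') bf (adapted_measurable aU)).
apply: adapted_independent SS' aU _.
exact: measurable_id.
Qed.

Lemma bounded_measurable_mean_field S (d1 : measure_display)
    (T1 : measurableType d1) (f : T1 -> Omega -> R) :
  bounded_measurable (fun p : T1 * block_space F S => f p.1 p.2) ->
  bounded_measurable (fun y => mean P (f y)).
Proof.
by move=> bf; exact: (bounded_measurable_mean P (@block_space_id S) bf).
Qed.

Lemma same_law_comp (d1 d2 : measure_display) (T1 : measurableType d1)
    (T2 : measurableType d2) (h : T1 -> T2) (f f' : Omega -> T1) :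
  measurable_fun [set: T1] h -> same_law P f f' ->
  same_law P (fun w => h (f w)) (fun w => h (f' w)).
Proof.
move=> mh ff' phi bphi; apply: (ff' (fun x => phi (h x))).
exact: bounded_measurable_comp bphi mh.
Qed.

(** The test function is the identity, cut off beyond the range of both
    variables. *)
Lemma same_law_mean (f f' : Omega -> R) : same_law P f f' ->
  bounded_measurable f -> bounded_measurable f' -> mean P f = mean P f'.
Proof.
move=> ff' [mf [B fB]] [mf' [B' fB']].
pose D := Num.max B B'.
have fD w : `|f w| <= D by rewrite le_max fB.
have fD' w : `|f' w| <= D by rewrite le_max fB' orbT.
have D0 : 0 <= D by exact: le_trans (fD point).
have := ff' _ (bounded_measurable_clamp D0).
under eq_fun do rewrite clampE//.
by under [in RHS]eq_fun do rewrite clampE//.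
Qed.

(** Both laws are products, by independence; the factors are exchanged one
    after the other. *)
Lemma same_law_pair S1 S2 S1' S2' (d1 d2 d3 : measure_display)
    (T1 : measurableType d1) (T2 : measurableType d2) (T3 : measurableType d3)
    (U U' : Omega -> T1) (V V' : Omega -> T2) (h : T1 -> T2 -> T3) :
  [disjoint S1 & S2] -> [disjoint S1' & S2'] ->
  adapted F S1 U -> adapted F S2 V -> adapted F S1' U' -> adapted F S2' V' ->
  measurable_fun [set: T1 * T2] (fun p => h p.1 p.2) ->
  same_law P U U' -> same_law P V V' ->
  same_law P (fun w => h (U w) (V w)) (fun w => h (U' w) (V' w)).
Proof.
move=> S12 S12' aU aV aU' aV' mh UU' VV' phi bphi.
have bh := bounded_measurable_comp bphi mh.
have mU := adapted_measurable aU; have mU' := adapted_measurable aU'.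
have mV := adapted_measurable aV; have mV' := adapted_measurable aV'.
rewrite (mean_freeze mV bh mU)/=; last exact: adapted_independent S12 aU aV.
rewrite (mean_freeze mV' bh mU')/=; last exact: adapted_independent S12' aU' aV'.
rewrite (UU' _ (bounded_measurable_mean P mV bh)).
congr (mean P _); apply/funext => w' /=.
apply: (VV' (fun v => phi (h (U' w') v))).
exact: (bounded_measurable_comp bh (pair1_measurable (U' w'))).
Qed.

Section sums.
Context (K : choiceType).
Implicit Types (J : seq K) (Z : K -> Omega -> R).

Definition pairwise_disjoint (S : K -> set I) := forall k k', k != k' -> [disjoint S k & S k'].

Let disjoint_tail (S : K -> set I) J k : pairwise_disjoint S -> k \notin J ->
  [disjoint S k & \bigcup_(j in [set` J]) S j].
Proof.
move=> dS kJ; apply/disj_setPS => t [Skt [j /= jJ Sjt]].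
have kj : k != j by apply: contraNneq kJ => ->.
by move/disj_setPS : (dS _ _ kj) => /(_ t); apply.
Qed.

Lemma same_law_sum J (S S' : K -> set I) Z Z' : uniq J ->
  pairwise_disjoint S -> pairwise_disjoint S' ->
  (forall k, adapted F (S k) (Z k)) -> (forall k, adapted F (S' k) (Z' k)) ->
  (forall k, k \in J -> same_law P (Z k) (Z' k)) ->
  same_law P (fun w => \sum_(k <- J) Z k w) (fun w => \sum_(k <- J) Z' k w).
Proof.
move=> uJ dS dS' aZ aZ'; elim: J uJ => [_ _ phi _|k J IH /= /andP[kJ uJ] ZZ'].
  by congr (mean P _); apply/funext => w; rewrite !big_nil.
have sumE (Y : K -> Omega -> R) : (fun w => \sum_(j <- k :: J) Y j w) =
    fun w => Y k w + \sum_(j <- J) Y j w by apply/funext => w; rewrite big_cons.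
rewrite !sumE.
have pair := same_law_pair (disjoint_tail dS kJ) (disjoint_tail dS' kJ)
  (aZ k) (adapted_sum (J:=J) aZ) (aZ' k) (adapted_sum (J:=J) aZ').
apply: (pair _ _ (fun a b : R => a + b)).
- by apply: measurable_funD; [exact: measurable_fst|exact: measurable_snd].
- by apply: ZZ'; exact: mem_head.
- by apply: IH => // j jJ; apply: ZZ'; rewrite inE jJ orbT.
Qed.

Lemma mean_independentM S1 S2 (f g : Omega -> R) : [disjoint S1 & S2] ->
  adapted F S1 f -> adapted F S2 g ->
  (exists B, forall w, `|f w| <= B) -> (exists B, forall w, `|g w| <= B) ->
  mean P (fun w => f w * g w) = mean P f * mean P g.
Proof.
move=> S12 af ag [B fB] [C gC].
have mf := adapted_measurable af; have mg := adapted_measurable ag.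
have B0 : 0 <= B by exact: le_trans (fB point).
have C0 : 0 <= C by exact: le_trans (gC point).
(* Truncation makes the product a bounded function on the plane without
   changing it on the values that are taken. *)
have bh : bounded_measurable (fun p : R * R => clamp B p.1 * clamp C p.2).
  apply: bounded_measurableM.
  - exact: bounded_measurable_comp (bounded_measurable_clamp B0) measurable_fst.
  - exact: bounded_measurable_comp (bounded_measurable_clamp C0) measurable_snd.
rewrite (_ : (fun w => f w * g w) = fun w => clamp B (f w) * clamp C (g w)); last first.
  by apply/funext => w; rewrite !clampE.
rewrite (mean_freeze mg bh mf (adapted_independent S12 af ag))/=.
have bg : bounded_measurable g by split => //; exists C.
have bf : bounded_measurable f by split => //; exists B.
rewrite mulrC -meanZ//; congr (mean P _); apply/funext => w'.
rewrite [RHS]mulrC -meanZ//; congr (mean P _); apply/funext => w.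
by rewrite !clampE.
Qed.

(** Bienayme's identity as an upper bound: the mixed terms vanish because the
    summands are centred and each is independent of the sum of the others. *)
Lemma mean_sqr_centred_sum_le J (S : K -> set I) Z (v : R) : uniq J -> pairwise_disjoint S ->
  (forall k, adapted F (S k) (Z k)) ->
  (forall k, exists B, forall w, `|Z k w| <= B) ->
  (forall k, mean P (Z k) = 0) ->
  (forall k, mean P (fun w => Z k w ^+ 2) <= v) ->
  mean P (fun w => (\sum_(k <- J) Z k w) ^+ 2) <= (size J)%:R * v.
Proof.
move=> uJ dS aZ BZ Z0 Zv.
have bZ k : bounded_measurable (Z k).
  by split; [exact: adapted_measurable (aZ k)|exact: BZ].
elim: J uJ => [_|k J IH /= /andP[kJ uJ]].
  rewrite mul0r (_ : (fun w => _) = fun=> 0) ?mean_cst//.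
  by apply/funext => w; rewrite big_nil expr0n.
have bs := bounded_measurable_sum J bZ.
rewrite (_ : (fun w => _) = fun w => Z k w ^+ 2 +
    2 * (Z k w * \sum_(j <- J) Z j w) + (\sum_(j <- J) Z j w) ^+ 2); last first.
  by apply/funext => w; rewrite big_cons; ring.
rewrite meanD; last 2 first.
- apply: bounded_measurableD; first exact: bounded_measurable_sqr.
  by apply: bounded_measurableZ; exact: bounded_measurableM.
- exact: bounded_measurable_sqr.
rewrite meanD ?meanZ; last 3 first.
- exact: bounded_measurableM.
- exact: bounded_measurable_sqr.
- by apply: bounded_measurableZ; exact: bounded_measurableM.
rewrite (mean_independentM (disjoint_tail dS kJ) (aZ k) (adapted_sum (J:=J) aZ))//;
  last exact: bs.2.
by rewrite Z0 mul0r mulr0 addr0 -natr1 mulrDl mul1r addrC lerD// IH.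
Qed.

End sums.
End adapted_block.

(** * The fixed point *)

Section fixed_point.
Context (R : realType) (dO dE : measure_display).
Context (Omega : measurableType dO) (P : probability Omega R).
Context (E : measurableType dE) (Y : E -> Omega -> E).
Hypothesis mY : forall x, measurable_fun [set: Omega] (Y x).
Hypothesis mean_Y : forall h : E -> R, bounded_measurable h ->
  bounded_measurable (fun x => mean P (fun w => h (Y x w))).
Variables (delta B : R) (g G : E -> R).
Hypothesis delta_ge0 : 0 <= delta.
Hypothesis delta_lt1 : delta < 1.
Hypothesis g_meas : measurable_fun [set: E] g.
Hypothesis G_meas : measurable_fun [set: E] G.
Hypothesis gB : forall x, `|g x| <= B.
Hypothesis GB : forall x, `|G x| <= B.

Definition bellman (q : E -> R) (x : E) : R :=
  g x + delta * mean P (fun w => Num.max (G (Y x w)) (q (Y x w))).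

Let bm_max q : bounded_measurable q ->
  bounded_measurable (fun y => Num.max (G y) (q y)).
Proof. by move=> bq; apply: bounded_measurable_max => //; split => //; exists B. Qed.

Let bm_maxY q x : bounded_measurable q ->
  bounded_measurable (fun w => Num.max (G (Y x w)) (q (Y x w))).
Proof. by move=> bq; exact: bounded_measurable_comp (bm_max bq) (mY x). Qed.

Lemma bounded_measurable_bellman q : bounded_measurable q ->
  bounded_measurable (bellman q).
Proof.
move=> bq; apply: bounded_measurableD; first by split => //; exists B.
by apply: bounded_measurableZ; exact: mean_Y (bm_max bq).
Qed.

Lemma bellman_le q q' : bounded_measurable q -> bounded_measurable q' ->
  (forall x, q x <= q' x) -> forall x, bellman q x <= bellman q' x.
Proof.
move=> bq bq' qq' x; rewrite lerD2l ler_wpM2l//.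
apply: mean_le => [||w]; [exact: bm_maxY|exact: bm_maxY|].
by rewrite ge_max !le_max lexx qq' orbT.
Qed.

Lemma bellman_bound q c : bounded_measurable q -> B <= c ->
  (forall x, `|q x| <= c) -> forall x, `|bellman q x| <= B + delta * c.
Proof.
move=> bq Bc qc x; rewrite (le_trans (ler_normD _ _))// lerD//.
rewrite normrM (ger0_norm delta_ge0) ler_wpM2l//.
apply: norm_mean_le_cst => [|w]; first exact: bm_maxY.
by apply: ler_norm_max => //; exact: le_trans (GB _) Bc.
Qed.

(** A bounded function whose uniform bounds improve by the affine contraction
    [c |-> a + delta * c] is bounded by the fixed point of that contraction. *)
Lemma contraction_bound (h : E -> R) (a : R) : (exists K, forall x, `|h x| <= K) ->
  (forall c, 0 <= c -> (forall x, `|h x| <= c) -> forall x, `|h x| <= a + delta * c) ->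
  forall x, `|h x| <= a / (1 - delta).
Proof.
move=> [K hK] step x; set A := range (fun x => `|h x|).
have A_ub : has_ubound A by exists K => _ [y _ <-].
have hS y : `|h y| <= sup A by apply: ub_le_sup => //; exists y.
have S0 : 0 <= sup A by exact: le_trans (hS point).
have : sup A <= a + delta * sup A.
  by apply: ge_sup => [|_ [y _ <-]]; [exists `|h point|, point|exact: step].
rewrite -lerBlDr -[X in X - _]mul1r -mulrBl mulrC -ler_pdivlMr ?subr_gt0//.
exact: le_trans (hS x).
Qed.

(** The contraction is [c |-> (B + B) + delta * c], as the maximum of [G] and
    [q] is at most [B + c]. The bound depends on the problem through [B] and
    [delta] only, which makes the error of level zero uniform. *)
Lemma bellman_fixed_bound q : bounded_measurable q -> q = bellman q ->
  forall x, `|q x| <= (B + B) / (1 - delta).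
Proof.
move=> bq qE; apply: contraction_bound; first exact: bq.2.
move=> c c0 qc x; have B0 : 0 <= B := le_trans (normr_ge0 _) (gB point).
rewrite qE (le_trans (bellman_bound (c := B + c) bq _ _ x))//.
- by rewrite lerDl.
- by move=> y; rewrite (le_trans (qc y))// lerDr.
- by rewrite mulrDr addrA lerD2r lerD2l ler_piMl// ltW.
Qed.

Lemma bellman_fixed_unique q q' : bounded_measurable q -> bounded_measurable q' ->
  q = bellman q -> q' = bellman q' -> q = q'.
Proof.
move=> bq bq' qE qE'; apply/funext => x; apply/eqP; rewrite -subr_eq0 -normr_le0.
rewrite -[leRHS](mul0r (1 - delta)^-1).
apply: (contraction_bound (h := fun x => q x - q' x)).
  exact: (bounded_measurableB bq bq').2.
move=> c c0 qc y; rewrite add0r {1}qE {1}qE' /bellman opprD addrACA subrr add0r.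
rewrite -mulrBr normrM (ger0_norm delta_ge0) ler_wpM2l// -meanB; try exact: bm_maxY.
apply: norm_mean_le_cst => [|w].
  by apply: bounded_measurableB; exact: bm_maxY.
exact: le_trans (max_dist _ _ _) (qc _).
Qed.

(* The operator maps the functions bounded by this constant to themselves. *)
Let K : R := B / (1 - delta).

Let B_ge0 : 0 <= B. Proof. exact: le_trans (gB point). Qed.

Let BK : B + delta * K = K.
Proof. by rewrite /K; field; rewrite subr_eq0 gt_eqF. Qed.

Let BleK : B <= K.
Proof.
by rewrite -BK lerDl mulr_ge0// mulr_ge0// invr_ge0 subr_ge0 ltW.
Qed.

Let picard n : E -> R := iter n bellman (fun=> - K).

Let bm_picard n : bounded_measurable (picard n).
Proof.
elim: n => [|n IH]; first exact: bounded_measurable_cst.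
exact: bounded_measurable_bellman.
Qed.

Let picard_bound n x : `|picard n x| <= K.
Proof.
elim: n x => [|n IH] x; first by rewrite normrN ger0_norm// (le_trans B_ge0).
by rewrite -[leRHS]BK; exact: bellman_bound.
Qed.

Let picard_nd x : nondecreasing_seq (fun n => picard n x).
Proof.
apply/nondecreasing_seqP => n; elim: n x => [|n IH] x.
  by have := picard_bound 1 x; rewrite ler_norml => /andP[].
exact: (bellman_le (bm_picard n) (bm_picard n.+1) IH).
Qed.

Let qlim x : R := lim (picard n x @[n --> \oo]).

Let picard_cvg x : picard n x @[n --> \oo] --> qlim x.
Proof.
apply: nondecreasing_is_cvgn; first exact: picard_nd.
by exists K => _ [n _ <-]; exact: le_trans (ler_norm _) (picard_bound n x).
Qed.

Let qlim_bound x : `|qlim x| <= K.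
Proof.
rewrite ler_norml; apply/andP; split.
- apply: limr_ge; first exact: picard_cvg.
  by apply: nearW => n; have := picard_bound n x; rewrite ler_norml => /andP[].
- apply: limr_le; first exact: picard_cvg.
  by apply: nearW => n; exact: le_trans (ler_norm _) (picard_bound n x).
Qed.

Let bm_qlim : bounded_measurable qlim.
Proof.
split; last by exists K => x; exact: qlim_bound.
by apply: (measurable_fun_cvg (fun n => (bm_picard n).1)) => x _; exact: picard_cvg.
Qed.

(** Picard iteration from the constant [- K], which is a subsolution, increases
    to the fixed point; dominated convergence passes to the limit under the
    mean. *)
Lemma bellman_fixed_exists : exists2 q, bounded_measurable q & q = bellman q.
Proof.
exists qlim => //; apply/funext => x.
have cvg_bellman : picard n.+1 x @[n --> \oo] --> bellman qlim x.
  apply: cvgD; first exact: cvg_cst.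
  apply: cvgM; first exact: cvg_cst.
  pose f n w := Num.max (G (Y x w)) (picard n (Y x w)).
  have bf n : bounded_measurable (f n) by exact: bm_maxY.
  have bl := bm_maxY x bm_qlim.
  have intE h : bounded_measurable h -> (\int[P]_w (h w)%:E = (mean P h)%:E)%E.
    by move=> bh; rewrite -mean_fin// unlock.
  suff lim : (fun n => (mean P (f n))%:E) @ \oo -->
      (mean P (fun w => Num.max (G (Y x w)) (qlim (Y x w))))%:E.
    exact: (fine_cvg lim).
  rewrite -(intE _ bl) (_ : (fun n => _) = fun n => (\int[P]_w (f n w)%:E)%E);
    last by apply/funext => n; rewrite intE.
  have [] := @dominated_convergence _ _ _ P setT measurableT
    (fun n w => (f n w)%:E) (fun w => (Num.max (G (Y x w)) (qlim (Y x w)))%:E)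
    (fun=> K%:E) => //.
  - by move=> n; apply/measurable_EFinP; exact: (bf n).1.
  - by apply/measurable_EFinP; exact: bl.1.
  - apply: aeW => w _; apply: cvg_EFin; first exact: nearW.
    apply: (@continuous2_cvg _ _ _ _ _ _ _ _ (fun a b : R => Num.max a b)).
    + exact: (@max_continuous _ R (_, _)).
    + exact: cvg_cst.
    + exact: picard_cvg.
  - exact: bounded_integrable (bounded_measurable_cst _ K).
  - apply: aeW => w n _; rewrite lee_fin; apply: ler_norm_max => //.
    exact: le_trans (GB _) BleK.
have cvg_shift := @picard_cvg x.
rewrite -(cvg_shiftS (fun n => picard n x)) in cvg_shift.
exact: (cvg_unique _ cvg_shift cvg_bellman).
Qed.

End fixed_point.

(** * The tree of indices *)

(** The indices that feed [Q n theta]: the strict extensions of [theta]. They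
    are divided into levels, by the absolute value of the first new entry, and
    the levels into fibers, by the second new entry. The absolute value
    matters: the sample [i] of level [l] uses the extensions of both
    [theta ++ [:: l; i]] and [theta ++ [:: - l; i]], which lie in the same
    fiber, while distinct samples use distinct fibers. *)
Definition below (theta : Theta) : set Theta :=
  [set eta | exists a r, val eta = val theta ++ a :: r].

Definition level (theta : Theta) (l : nat) : set Theta :=
  [set eta | exists a r, `|a|%N = l /\ val eta = val theta ++ a :: r].

Definition fiber (theta : Theta) (l i : nat) : set Theta :=
  [set eta | exists a r, `|a|%N = l /\ val eta = val theta ++ [:: a, i%:Z & r]].

Lemma val_theta_ext theta l i : val (theta_ext theta l i) = val theta ++ [:: l; i].
Proof. by []. Qed.

Lemma cat_injl (T : Type) (s t u : seq T) : s ++ t = s ++ u -> t = u.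
Proof. by elim: s => //= x s IH [/IH]. Qed.

Lemma level_disjoint theta : pairwise_disjoint (level theta).
Proof.
move=> k k' kk'; apply/disj_setPS => t [[a [r [ak ta]]] [a' [r' [ak' ta']]]].
have /cat_injl[aa' _] := etrans (esym ta) ta'.
by move/eqP : kk'; apply; rewrite -ak -ak' aa'.
Qed.

Lemma fiber_disjoint theta l : pairwise_disjoint (fiber theta l).
Proof.
move=> k k' kk'; apply/disj_setPS => t [[a [r [ak ta]]] [a' [r' [ak' ta']]]].
have /cat_injl[_ kE _] := etrans (esym ta) ta'.
by move/eqP : kk'; apply.
Qed.

Lemma fiber_level theta l i : fiber theta l i `<=` level theta l.
Proof. by move=> t [a [r [al E]]]; exists a, (i%:Z :: r). Qed.

Lemma level_below theta l : level theta l `<=` below theta.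
Proof. by move=> t [a [r [_ E]]]; exists a, r. Qed.

Lemma below_fiber theta l i (a : int) : `|a|%N = l ->
  below (theta_ext theta a i%:Z) `<=` fiber theta l i.
Proof.
move=> al t [b [r tb]]; exists a, (b :: r); split => //.
by rewrite tb val_theta_ext -catA.
Qed.

Lemma node_fiber theta l i (a : int) : `|a|%N = l ->
  [set theta_ext theta a i%:Z] `<=` fiber theta l i.
Proof. by move=> al t ->; exists a, [::]. Qed.

Lemma node_below_disjoint theta (a b i : int) :
  [disjoint [set theta_ext theta a i] & below (theta_ext theta b i)].
Proof.
apply/disj_setPS => t [-> [c [r /(congr1 size)]]].
by rewrite !val_theta_ext !size_cat /=; lia.
Qed.

Lemma below_below_disjoint theta (a b i : int) : a != b ->
  [disjoint below (theta_ext theta a i) & below (theta_ext theta b i)].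
Proof.
move=> ab; apply/disj_setPS => t [[c [r tc]] [c' [r' tc']]].
have := etrans (esym tc) tc'.
by rewrite !val_theta_ext -!catA => /cat_injl[/eqP]; rewrite (negbTE ab).
Qed.

(** * The approximation scheme: bounds, measurability and law *)

Section scheme.
Context (R : realType) (M : nat) (dO : measure_display).
Context (Omega : measurableType dO) (P : probability Omega R).
Context (dE : measure_display) (E : measurableType dE).
Variables (F : Theta -> set (set Omega)) (X : Theta -> E -> Omega -> E).
Hypothesis M_gt0 : (0 < M)%N.
Hypothesis F_sub : forall t, sub_sigma_algebra_of (F t).
Hypothesis F_indep : independent_systems P F.
Hypothesis X_iid : iid_random_fields P X.
Hypothesis X_meas : forall t, jointly_measurable (F t) (X t).
Variables (delta B : R) (g G : E -> R).
Hypothesis delta01 : 0 <= delta <= 1.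
Hypothesis g_meas : measurable_fun [set: E] g.
Hypothesis G_meas : measurable_fun [set: E] G.
Hypothesis gB : forall x, `|g x| <= B.
Hypothesis GB : forall x, `|G x| <= B.
Variable Q : nat -> Theta -> E -> Omega -> R.

(** The summand of level [l] of the scheme as a random field in the position
    [y]; [sample] evaluates it at the random next position, which is
    independent of the field. *)
Definition correction (l : nat) (eta eta' : Theta) (y : E) (w : Omega) : R :=
  Num.max (G y) (Q l eta y w) - (0 < l)%N%:R * Num.max (G y) (Q l.-1 eta' y w).

Definition sample (theta : Theta) (l i : nat) (x : E) (w : Omega) : R :=
  correction l (theta_ext theta l%:Z i%:Z) (theta_ext theta (- l%:Z) i%:Z)
    (X (theta_ext theta l%:Z i%:Z) x w) w.

Hypothesis Q_def : forall n theta x w,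
  Q n theta x w = g x + \sum_(0 <= l < n) delta / M%:R ^+ (n - l) *
    \sum_(1 <= i < (M ^ (n - l)).+1) sample theta l i x w.

Lemma scheme0 theta x w : Q 0 theta x w = g x.
Proof. by rewrite Q_def big_geq// addr0. Qed.

Let B_ge0 : 0 <= B. Proof. exact: le_trans (gB point). Qed.

Let correction_bound_of l eta eta' y w :
  (forall k theta, (k <= l)%N -> `|Q k theta y w| <= B * 3 ^+ k) ->
  `|correction l eta eta' y w| <= B * 3 ^+ l *+ 2.
Proof.
move=> QB.
have le3 k : B <= B * 3 ^+ k by rewrite ler_peMr// exprn_ege1// ler1n.
rewrite mulr2n (le_trans (ler_normB _ _))// lerD//.
  by apply: ler_norm_max; [exact: le_trans (GB y) (le3 l)|exact: QB].
case: l QB => [|l] QB; first by rewrite mul0r normr0 mulr_ge0// exprn_ge0.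
rewrite mul1r/=; apply: ler_norm_max; first exact: le_trans (GB y) (le3 _).
rewrite (le_trans (QB l _ (leqnSn l)))// ler_wpM2l// ler_weXn2l//.
by rewrite ler1n.
Qed.

(** Each level [l < n] contributes at most twice the bound of [Q l], and
    [1 + 2 * (1 + 3 + ... + 3 ^ (n - 1)) = 3 ^ n]. *)
Lemma scheme_bound n theta x w : `|Q n theta x w| <= B * 3 ^+ n.
Proof.
elim/ltn_ind: n theta x w => n IH theta x w.
have samp l i : (l < n)%N -> `|sample theta l i x w| <= B * 3 ^+ l *+ 2.
  move=> ln; apply: correction_bound_of => k eta kl.
  by apply: IH; exact: leq_ltn_trans kl ln.
rewrite Q_def (le_trans (ler_normD _ _))//.
have lvl : `|\sum_(0 <= l < n) delta / M%:R ^+ (n - l) *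
    \sum_(1 <= i < (M ^ (n - l)).+1) sample theta l i x w|
    <= \sum_(0 <= l < n) B * 3 ^+ l *+ 2.
  rewrite big_nat [leRHS]big_nat (le_trans (ler_norm_sum _ _ _))//.
  apply: ler_sum => l /= ln.
  have Mn0 : 0 < M%:R ^+ (n - l) :> R by rewrite exprn_gt0// ltr0n.
  case/andP: delta01 => d0 d1.
  rewrite !normrM normfV (ger0_norm d0) (ger0_norm (ltW Mn0)).
  rewrite -mulrA (le_trans (ler_piMl _ d1))//.
  rewrite ler_pdivrMl// (le_trans (ler_norm_sum _ _ _))//.
  rewrite (le_trans (ler_sum _ (fun i _ => samp l i ln)))//.
  by rewrite sumr_const_nat subSS subn0 -[leLHS]mulr_natl natrX.
apply: le_trans (lerD (gB x) lvl) _; rewrite le_eqVlt; apply/orP; left.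
apply/eqP; elim: n {IH samp lvl} => [|n IH]; first by rewrite big_geq// addr0 mulr1.
by rewrite big_nat_recr//= addrA IH exprS mulr2n; ring.
Qed.

Lemma scheme_bounded n theta x : exists C, forall w, `|Q n theta x w| <= C.
Proof. by exists (B * 3 ^+ n); exact: scheme_bound. Qed.

Let field_sub (S S' : set Theta) (d1 : measure_display) (T1 : measurableType d1)
    (f : E -> Omega -> T1) : S `<=` S' ->
  measurable_fun [set: E * block_space F S] (fun p => f p.1 p.2) ->
  measurable_fun [set: E * block_space F S'] (fun p => f p.1 p.2).
Proof.
move=> SS' mf.
have m2 : measurable_fun [set: E * block_space F S']
    (fun p => p.2 : block_space F S).
  by have := measurableT_comp (block_space_incl (F := F) SS')
    (measurable_snd (T1 := E)).
have mi : measurable_fun [set: E * block_space F S']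
    (fun p : E * block_space F S' => (p.1, p.2) : E * block_space F S).
  exact: measurable_fun_pair measurable_fst m2.
exact: (measurableT_comp mf mi).
Qed.

Lemma X_field theta : measurable_fun [set: E * block_space F [set theta]]
  (fun p => X theta p.1 p.2).
Proof.
have e : block F [set theta] = F theta by exact: bigcup_set1.
by rewrite e; exact: X_meas.
Qed.

Let field_at (S : set Theta) (theta : Theta) (f : E -> Omega -> R) :
  S theta -> measurable_fun [set: E * block_space F S] (fun p => f p.1 p.2) ->
  measurable_fun [set: E * block_space F S] (fun p => f (X theta p.1 p.2) p.2).
Proof.
move=> St mf.
have SX : [set theta] `<=` S by move=> _ ->.
have mX := field_sub (f := X theta) SX (@X_field theta).
have mi : measurable_fun [set: E * block_space F S]
    (fun p : E * block_space F S => (X theta p.1 p.2, p.2) : E * block_space F S).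
  exact: measurable_fun_pair mX measurable_snd.
exact: (measurableT_comp mf mi).
Qed.

Let correction_field_of l (S S' : set Theta) eta eta' :
  measurable_fun [set: E * block_space F S] (fun p => Q l eta p.1 p.2) ->
  measurable_fun [set: E * block_space F S'] (fun p => Q l.-1 eta' p.1 p.2) ->
  measurable_fun [set: E * block_space F (S `|` S')]
    (fun p => correction l eta eta' p.1 p.2).
Proof.
move=> mQ mQ'.
have mG : measurable_fun [set: E * block_space F (S `|` S')] (fun p => G p.1).
  exact: measurableT_comp G_meas measurable_fst.
apply: measurable_funB.
  by apply: measurable_maxr => //; apply: field_sub mQ; exact: subsetUl.
apply: measurable_funM; first exact: measurable_cst.
by apply: measurable_maxr => //; apply: field_sub mQ'; exact: subsetUr.
Qed.

Let sample_field_of theta l i :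
  (forall k eta, (k <= l)%N -> measurable_fun [set: E * block_space F (below eta)]
    (fun p => Q k eta p.1 p.2)) ->
  measurable_fun [set: E * block_space F (fiber theta l i)]
    (fun p => sample theta l i p.1 p.2).
Proof.
move=> mQ; apply: field_at; first exact: (node_fiber (a := l)).
apply: field_sub (correction_field_of (mQ _ _ (leqnn l)) (mQ _ _ (leq_pred l))).
by move=> t [|]; apply: below_fiber; lia.
Qed.

(** Joint measurability in the position and the randomness is what makes it
    meaningful to evaluate [Q n theta] at a random position. *)
Lemma scheme_field n theta :
  measurable_fun [set: E * block_space F (below theta)]
    (fun p => Q n theta p.1 p.2).
Proof.
elim/ltn_ind: n theta => n IH theta.
under eq_fun do rewrite Q_def.
apply: measurable_funD; first exact: measurableT_comp g_meas measurable_fst.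
rewrite /index_iota subn0.
have : {subset iota 0 n <= [pred l | (l < n)%N]} by move=> l; rewrite mem_iota.
elim: (iota 0 n) => [_|l s IHs sn].
  by under eq_fun do rewrite big_nil; exact: measurable_cst.
under eq_fun do rewrite big_cons.
apply: measurable_funD; last by apply: IHs => k ks; apply: sn; rewrite inE ks orbT.
apply: measurable_funM; first exact: measurable_cst.
apply: measurable_sum => i.
apply: field_sub (sample_field_of _) => [t /fiber_level/level_below//|k eta kl].
by apply: IH; apply: leq_ltn_trans kl _; apply: (sn l); exact: mem_head.
Qed.

Lemma correction_bound l eta eta' y w :
  `|correction l eta eta' y w| <= B * 3 ^+ l *+ 2.
Proof. by apply: correction_bound_of => k theta _; exact: scheme_bound. Qed.

Lemma correction_field l eta eta' :
  bounded_measurable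
    (fun p : E * block_space F (below eta `|` below eta') =>
      correction l eta eta' p.1 p.2).
Proof.
split; last by eexists => p; exact: correction_bound.
exact: correction_field_of (@scheme_field l eta) (@scheme_field l.-1 eta').
Qed.

Lemma sample_field theta l i :
  measurable_fun [set: E * block_space F (fiber theta l i)]
    (fun p => sample theta l i p.1 p.2).
Proof. by apply: sample_field_of => k eta _; exact: scheme_field. Qed.

Lemma sample_adapted theta l i x : adapted F (fiber theta l i) (sample theta l i x).
Proof. exact: adapted_section (@sample_field theta l i). Qed.

Lemma sample_bounded theta l i x : exists C, forall w, `|sample theta l i x w| <= C.
Proof. by eexists => w; exact: correction_bound. Qed.

Lemma scheme_adapted n theta x : adapted F (below theta) (Q n theta x).
Proof. exact: adapted_section (@scheme_field n theta). Qed.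

Lemma X_adapted theta x : adapted F [set theta] (X theta x).
Proof. exact: (measurableT_comp (@X_field theta) (pair1_measurable x)). Qed.

(** Equality of the laws of the whole random fields is used for cylinders over
    a single starting point. *)
Lemma X_law theta theta' x : same_law P (X theta x) (X theta' x).
Proof.
move=> phi bphi; apply: EFin_inj.
have mX t := adapted_measurable F_sub (@X_adapted t x).
have bX t := bounded_measurable_comp bphi (mX t).
rewrite -!mean_fin// !unlock.
have pushE t : (\int[P]_w (phi (X t x w))%:E)%E =
    (\int[pushforward P (X t x)]_y (phi y)%:E)%E.
  rewrite integral_pushforward//; last exact: bounded_integrable (bX t).
  by apply/measurable_EFinP; exact: bphi.1.
rewrite !pushE; apply: eq_measure_integral => A mA _.
have [_ _ idX] := X_iid.
have := idX theta theta' [set f | A (f x)]; apply.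
by apply: sub_sigma_algebra; exists x, A.
Qed.

(** The next position has the same law for all indices, so that it may be
    taken at the reference index [theta0]. The test function is merely locally
    bounded, which covers the identity and the square. *)
Lemma sample_freeze theta l (i : nat) x (phi : R -> R) :
  measurable_fun [set: R] phi ->
  (forall r, exists C, forall a, `|a| <= r -> `|phi a| <= C) ->
  let eta := theta_ext theta l%:Z i%:Z in
  let eta' := theta_ext theta (- l%:Z) i%:Z in
  bounded_measurable (fun y => mean P (fun w => phi (correction l eta eta' y w))) /\
  mean P (fun w => phi (sample theta l i x w)) =
  mean P (fun w' => mean P (fun w =>
    phi (correction l eta eta' (X theta0 x w') w))).
Proof.
move=> mphi bphi eta eta'.
have bf : bounded_measurable
    (fun p : E * block_space F (below eta `|` below eta') =>
      phi (correction l eta eta' p.1 p.2)).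
  split; first exact: measurableT_comp mphi (correction_field l eta eta').1.
  have [C phiC] := bphi (B * 3 ^+ l *+ 2).
  by exists C => p; apply: phiC; exact: correction_bound.
pose f y w := phi (correction l eta eta' y w).
have bm := bounded_measurable_mean_field (f := f) P F_sub bf.
split => //.
have dis : [disjoint [set eta] & below eta `|` below eta'].
  apply/disj_setPS => t [tE [tb|tb]].
  - by have /disj_setPS := node_below_disjoint theta l l i; move/(_ t); apply.
  - by have /disj_setPS := node_below_disjoint theta l (- l%:Z) i; move/(_ t); apply.
rewrite (mean_freeze_field (f := f) F_sub F_indep dis (@X_adapted eta x) bf).
exact: (X_law eta theta0 x bm).
Qed.

(** By induction, the law of each sample is determined by the laws of lower
    levels: freeze the next position, then use that the two approximations
    which are subtracted are independent. The scheme is a function of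
    independent samples. *)
Lemma scheme_law n theta theta' x : same_law P (Q n theta x) (Q n theta' x).
Proof.
elim/ltn_ind: n theta theta' x => n IH theta theta' x.
have law_sample l i : (l < n)%N ->
    same_law P (sample theta l i x) (sample theta' l i x).
  move=> ln phi [mphi [C phiC]].
  have bphi r : exists C, forall a, `|a| <= r -> `|phi a| <= C by exists C.
  rewrite (sample_freeze theta l i x mphi bphi).2.
  rewrite (sample_freeze theta' l i x mphi bphi).2.
  congr (mean P _); apply/funext => w'; move: (X theta0 x w') => y.
  suff law : same_law P
      (correction l (theta_ext theta l i) (theta_ext theta (- l%:Z) i) y)
      (correction l (theta_ext theta' l i) (theta_ext theta' (- l%:Z) i) y).
    by apply: law; split => //; exists C.
  have mmax : measurable_fun [set: R] (fun a => Num.max (G y) a).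
    exact: measurable_maxr.
  (* At level zero both indices coincide, but the second term is absent. *)
  case: l ln => [|l] ln.
    have E0 t t' : correction 0 t t' y = fun w => Num.max (G y) (Q 0 t y w).
      by apply/funext => w; rewrite /correction mul0r subr0.
    by rewrite !E0; apply: same_law_comp mmax _; exact: IH.
  have dis t : [disjoint below (theta_ext t l.+1 i) &
      below (theta_ext t (- l.+1%:Z) i)] by apply: below_below_disjoint; lia.
  have pair := same_law_pair F_sub F_indep (dis theta) (dis theta')
    (@scheme_adapted l.+1 (theta_ext theta l.+1 i) y)
    (@scheme_adapted l (theta_ext theta (- l.+1%:Z) i) y)
    (@scheme_adapted l.+1 (theta_ext theta' l.+1 i) y)
    (@scheme_adapted l (theta_ext theta' (- l.+1%:Z) i) y).
  pose h (p : R * R) := Num.max (G y) p.1 - Num.max (G y) p.2.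
  have mh : measurable_fun [set: R * R] h.
    apply: measurable_funB; first exact: measurableT_comp mmax measurable_fst.
    exact: measurableT_comp mmax measurable_snd.
  have E1 t t' : correction l.+1 t t' y = fun w => h (Q l.+1 t y w, Q l t' y w).
    by apply/funext => w; rewrite /correction mul1r.
  rewrite !E1; apply: (pair _ _ (fun a b => h (a, b))).
  - by move: mh; rewrite (_ : h = fun p => h (p.1, p.2)).
  - exact: IH.
  - by apply: IH; exact: ltnW.
pose lev t l w : R := delta / M%:R ^+ (n - l) *
  \sum_(1 <= i < (M ^ (n - l)).+1) sample t l i x w.
have lev_adapted t l : adapted F (level t l) (lev t l).
  apply: (adapted_comp (h := fun a => delta / M%:R ^+ (n - l) * a)).
    exact: mulrl_measurable.
  have sub : \bigcup_(i in [set` index_iota 1 (M ^ (n - l)).+1]) fiber t l i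
    `<=` level t l by move=> u [i _]; exact: fiber_level.
  exact: (adapted_sub sub (adapted_sum (fun i => @sample_adapted t l i x))).
have QE t : Q n t x = fun w => g x + \sum_(0 <= l < n) lev t l w.
  by apply/funext => w; rewrite Q_def.
rewrite !QE; apply: (same_law_comp (h := fun a => g x + a)).
  by apply: measurable_funD => //; exact: measurable_id.
apply: (same_law_sum F_sub F_indep _ (@level_disjoint theta) (@level_disjoint theta')) => //.
  exact: iota_uniq.
move=> l; rewrite mem_index_iota => /andP[_ ln].
apply: (same_law_comp (h := fun a => delta / M%:R ^+ (n - l) * a)).
  exact: mulrl_measurable.
apply: (same_law_sum F_sub F_indep _ (@fiber_disjoint theta l)
  (@fiber_disjoint theta' l)).
- exact: iota_uniq.
- by move=> i; exact: sample_adapted.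
- by move=> i; exact: sample_adapted.
- by move=> i _; exact: law_sample.
Qed.


Lemma scheme_bounded_measurable n theta x : bounded_measurable (Q n theta x).
Proof.
by split; [exact: adapted_measurable (@scheme_adapted n theta x)
  |exact: scheme_bounded].
Qed.

Lemma sample_bounded_measurable theta l i x :
  bounded_measurable (sample theta l i x).
Proof.
by split; [exact: adapted_measurable (@sample_adapted theta l i x)
  |exact: sample_bounded].
Qed.

Lemma X_measurable theta x : measurable_fun [set: Omega] (X theta x).
Proof. exact: adapted_measurable (@X_adapted theta x). Qed.

(** * Mean and fluctuation of the scheme *)

Definition payoff (l : nat) (y : E) : R :=
  mean P (fun w => Num.max (G y) (Q l theta0 y w)).

Lemma payoffE l theta y :
  mean P (fun w => Num.max (G y) (Q l theta y w)) = payoff l y.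
Proof.
have bmax t : bounded_measurable (fun w => Num.max (G y) (Q l t y w)).
  apply: bounded_measurable_max; first exact: bounded_measurable_cst.
  exact: scheme_bounded_measurable.
apply: same_law_mean (bmax _) (bmax _).
apply: (same_law_comp (h := fun a => Num.max (G y) a)).
  exact: measurable_maxr.
exact: scheme_law.
Qed.

Lemma bounded_measurable_payoff l : bounded_measurable (payoff l).
Proof.
apply: (bounded_measurable_mean_field (S := below theta0)
  (f := fun y w => Num.max (G y) (Q l theta0 y w)) P F_sub).
split.
  apply: measurable_maxr; first exact: measurableT_comp G_meas measurable_fst.
  exact: scheme_field.
exists (B + B * 3 ^+ l) => p; have B0 := B_ge0.
apply: ler_norm_max; first by rewrite (le_trans (GB _))// lerDl mulr_ge0// exprn_ge0.
by rewrite (le_trans (scheme_bound _ _ _ _))// lerDr.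
Qed.

Definition value (l : nat) (x : E) : R :=
  mean P (fun w => payoff l (X theta0 x w)).

(** The mean is a difference of consecutive terms of one sequence, although the
    two subtracted approximations are indexed differently. *)
Lemma mean_sample theta l i x : mean P (sample theta l i x) =
  value l x - (0 < l)%N%:R * value l.-1 x.
Proof.
have id_bounded (r : R) : exists C, forall a : R, `|a| <= r -> `|a| <= C by exists r.
have mid : measurable_fun [set: R] (fun a : R => a) by exact: measurable_id.
rewrite (sample_freeze theta l i x mid id_bounded).2.
have bp k : bounded_measurable (fun w => payoff k (X theta0 x w)).
  exact: bounded_measurable_comp (bounded_measurable_payoff k) (@X_measurable theta0 x).
rewrite -meanZ// -meanB//; last exact: bounded_measurableZ.
congr (mean P _); apply/funext => w'; move: (X theta0 x w') => y.
have bmax k t : bounded_measurable (fun w => Num.max (G y) (Q k t y w)).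
  apply: bounded_measurable_max; first exact: bounded_measurable_cst.
  exact: scheme_bounded_measurable.
rewrite /correction meanB//; last exact: bounded_measurableZ.
by rewrite meanZ// !payoffE.
Qed.

Section error.
Variables (q : E -> R) (u : nat -> R).
Hypothesis q_bm : bounded_measurable q.
Hypothesis q_fix : forall x, q x = g x +
  delta * mean P (fun w => Num.max (G (X theta0 x w)) (q (X theta0 x w))).
Hypothesis u_ge0 : forall n, 0 <= u n.

(** The bound on the L2 norm of a sample of level [l] in terms of the error
    bounds [u]; level zero has no subtracted term. *)
Definition increment (l : nat) : R := if l is l'.+1 then u l + u l' else B.

Lemma increment_ge0 l : 0 <= increment l.
Proof. by case: l => [|l]; [exact: B_ge0|exact: addr_ge0]. Qed.

Definition accurate (l : nat) : Prop := forall theta y,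
  mean P (fun w => (Q l theta y w - q y) ^+ 2) <= u l ^+ 2.

Let bm_err l theta y : bounded_measurable (fun w => Q l theta y w - q y).
Proof.
apply: bounded_measurableB; first exact: scheme_bounded_measurable.
exact: bounded_measurable_cst.
Qed.

(** [Num.max c] is 1-Lipschitz, and both approximations are compared with
    [q]. *)
Lemma mean_sqr_sample theta l i x : accurate l -> accurate l.-1 ->
  mean P (fun w => sample theta l i x w ^+ 2) <= increment l ^+ 2.
Proof.
case: l => [_ _|l cl cl'].
  apply: mean_le_cst => [|w].
    exact/bounded_measurable_sqr/sample_bounded_measurable.
  rewrite -real_normK ?num_real// ler_pXn2r ?nnegrE ?B_ge0//.
  rewrite /sample /correction mul0r subr0 scheme0.
  by apply: ler_norm_max.
have sqr_bounded (r : R) : exists C, forall a : R, `|a| <= r -> `|a ^+ 2| <= C.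
  exists (r ^+ 2) => a ar; rewrite normrX ler_pXn2r ?nnegrE//.
  exact: le_trans ar.
have msqr : measurable_fun [set: R] (fun a : R => a ^+ 2) by exact: exprn_measurable.
have [bm ->] := sample_freeze theta l.+1 i x msqr sqr_bounded.
apply: mean_le_cst => [|w']; first exact: bounded_measurable_comp bm (@X_measurable theta0 x).
move: (X theta0 x w') => y {bm}.
set eta := theta_ext theta _ _; set eta' := theta_ext theta _ _.
have b1 := bounded_measurable_norm (bm_err l.+1 eta y).
have b2 := bounded_measurable_norm (bm_err l eta' y).
apply: (le_trans (y := mean P (fun w =>
    (`|Q l.+1 eta y w - q y| + `|Q l eta' y w - q y|) ^+ 2))).
  apply: mean_le => [||w].
  - apply/bounded_measurable_sqr/bounded_measurableB.
      apply: bounded_measurable_max; first exact: bounded_measurable_cst.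
      exact: scheme_bounded_measurable.
    apply/bounded_measurableZ/bounded_measurable_max.
      exact: bounded_measurable_cst.
    exact: scheme_bounded_measurable.
  - exact/bounded_measurable_sqr/bounded_measurableD.
  - rewrite -[leLHS]real_normK ?num_real// ler_pXn2r ?nnegrE ?addr_ge0//.
    rewrite /correction mul1r (le_trans (max_dist _ _ _))//= -normrN.
    rewrite -[X in _ <= _ + X]normrN -[X in _ <= X + _]normrN.
    rewrite (le_trans _ (ler_normB _ _))//.
    by rewrite le_eqVlt; apply/orP; left; apply/eqP; congr (`|_|); ring.
have sqE f : (fun w : Omega => `|f w| ^+ 2) = (fun w => (f w : R) ^+ 2).
  by apply/funext => w; rewrite real_normK// num_real.
by apply: mean_sqrD_le => //; rewrite sqE; [exact: cl|exact: cl'].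
Qed.

(** The centred contribution of level [l] to [Q n theta]. *)
Definition fluctuation (n : nat) (theta : Theta) (l : nat) (x : E) (w : Omega) : R :=
  delta / M%:R ^+ (n - l) * \sum_(1 <= i < (M ^ (n - l)).+1)
    (sample theta l i x w - mean P (sample theta l i x)).

Lemma bounded_measurable_fluctuation n theta l x :
  bounded_measurable (fluctuation n theta l x).
Proof.
apply/bounded_measurableZ/bounded_measurable_sum => i.
apply: bounded_measurableB; first exact: sample_bounded_measurable.
exact: bounded_measurable_cst.
Qed.

(** Averaging independent centred samples divides the second moment by their
    number, and centring does not increase it. *)
Lemma mean_sqr_fluctuation n theta l x (a : R) : a ^+ 2 = M%:R^-1 ->
  accurate l -> accurate l.-1 ->
  mean P (fun w => fluctuation n theta l x w ^+ 2)
    <= (delta * a ^+ (n - l) * increment l) ^+ 2.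
Proof.
move=> aM cl cl'; set k := (n - l)%N.
have M0 : 0 < M%:R :> R by rewrite ltr0n.
pose Z i w := sample theta l i x w - mean P (sample theta l i x).
have bZ i : bounded_measurable (Z i).
  apply: bounded_measurableB; first exact: sample_bounded_measurable.
  exact: bounded_measurable_cst.
have aZ i : adapted F (fiber theta l i) (Z i).
  have msub : measurable_fun [set: R] (fun a : R => a - mean P (sample theta l i x)).
    by apply: measurable_funB => //; exact: measurable_id.
  exact: (adapted_comp msub (@sample_adapted theta l i x)).
have Z0 i : mean P (Z i) = 0.
  rewrite meanB ?mean_cst ?subrr//; first exact: sample_bounded_measurable.
  exact: bounded_measurable_cst.
have Zv i : mean P (fun w => Z i w ^+ 2) <= increment l ^+ 2.
  apply: le_trans (mean_sqr_sample theta i x cl cl').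
  have bs := sample_bounded_measurable theta l i x.
  set s := sample theta l i x in bs *; set m := mean P s.
  rewrite (_ : (fun w => _) = fun w => s w ^+ 2 - (2 * m * s w - m ^+ 2)); last first.
    by apply/funext => w; rewrite /Z -/s -/m; ring.
  have bms : bounded_measurable (fun w => 2 * m * s w - m ^+ 2).
    by apply: bounded_measurableB; [exact: bounded_measurableZ|exact: bounded_measurable_cst].
  rewrite meanB//; last exact: bounded_measurable_sqr.
  rewrite meanB; [|exact: bounded_measurableZ|exact: bounded_measurable_cst].
  rewrite meanZ// mean_cst -/m lerBlDr lerDl.
  by rewrite (_ : _ - _ = m ^+ 2) ?sqr_ge0//; ring.
have sum_le := mean_sqr_centred_sum_le F_sub F_indep
  (iota_uniq 1 ((M ^ k).+1 - 1)) (@fiber_disjoint theta l) aZ (fun i => (bZ i).2) Z0 Zv.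
rewrite (_ : (fun w => _) = fun w => (delta / M%:R ^+ k) ^+ 2 *
    (\sum_(i <- iota 1 ((M ^ k).+1 - 1)) Z i w) ^+ 2); last first.
  by apply/funext => w; rewrite /fluctuation exprMn.
rewrite meanZ; last exact/bounded_measurable_sqr/bounded_measurable_sum.
apply: (le_trans (ler_wpM2l (sqr_ge0 _) sum_le)).
have ak : (a ^+ k) ^+ 2 = (M%:R ^+ k)^-1 by rewrite -exprM mulnC exprM aM exprVn.
rewrite size_iota subn1/= natrX !exprMn ak.
rewrite le_eqVlt; apply/orP; left; apply/eqP.
field.
by rewrite expf_neq0// gt_eqF.
Qed.

(** The means of the levels telescope, so that the bias is that of one step of
    the fixed-point iteration applied to the last level. *)
Lemma error_decomposition n theta x w :
  Q n.+1 theta x w - q x = \sum_(0 <= l < n.+1) fluctuation n.+1 theta l x w +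
    delta * (value n x -
      mean P (fun w => Num.max (G (X theta0 x w)) (q (X theta0 x w)))).
Proof.
have M0 : M%:R != 0 :> R by rewrite pnatr_eq0 -lt0n.
have telescope k : \sum_(0 <= l < k.+1)
    (value l x - (0 < l)%N%:R * value l.-1 x) = value k x.
  elim: k => [|k IH]; first by rewrite big_nat1 mul0r subr0.
  by rewrite big_nat_recr//= IH mul1r addrC subrK.
rewrite Q_def q_fix -[in RHS]telescope mulrBr mulr_sumr addrA -big_split/=.
rewrite opprD addrACA subrr add0r; congr (_ - _).
apply: eq_bigr => l _; rewrite /fluctuation.
under [in RHS]eq_bigr do rewrite mean_sample.
rewrite [in RHS]sumrB sumr_const_nat subSS subn0.
set z := value l x - _; rewrite -[z *+ _]mulr_natr natrX; set s := \sum_(_ <= _ < _) _.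
by field; rewrite expf_neq0.
Qed.

(** The fluctuations of the levels and the bias are estimated separately in L2;
    the bias compares two means of maxima with [G], hence is at most the L1
    distance between [Q n] and [q]. *)
Lemma error_step n (a : R) : 0 <= a -> a ^+ 2 = M%:R^-1 ->
  (forall l, (l <= n)%N -> accurate l) -> forall theta x,
  mean P (fun w => (Q n.+1 theta x w - q x) ^+ 2)
    <= (delta * (\sum_(0 <= l < n.+1) a ^+ (n.+1 - l) * increment l + u n)) ^+ 2.
Proof.
move=> a0 aM cl theta x; case/andP: delta01 => d0 d1.
rewrite mulrDr; under eq_fun do rewrite error_decomposition.
apply: mean_sqrD_le.
- apply: bounded_measurable_sum => l; exact: bounded_measurable_fluctuation.
- exact: bounded_measurable_cst.
- by rewrite mulr_ge0// sumr_ge0// => l _; rewrite mulr_ge0 ?exprn_ge0 ?increment_ge0.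
- by rewrite mulr_ge0.
- rewrite mulr_sumr; apply: mean_sqr_sum_le => l.
  + exact: bounded_measurable_fluctuation.
  + by rewrite !mulr_ge0 ?exprn_ge0 ?increment_ge0.
  + rewrite mem_index_iota => /andP[_ ln]; rewrite mulrA.
    apply: mean_sqr_fluctuation => //; apply: cl; first by [].
    by rewrite (leq_trans (leq_pred _)).
rewrite mean_cst !exprMn ler_wpM2l ?sqr_ge0//.
rewrite -[leLHS]real_normK ?num_real// ler_pXn2r ?nnegrE//.
have bp : bounded_measurable (fun w => payoff n (X theta0 x w)).
  exact: bounded_measurable_comp (bounded_measurable_payoff n) (@X_measurable theta0 x).
have bq : bounded_measurable (fun w => Num.max (G (X theta0 x w)) (q (X theta0 x w))).
  apply: (bounded_measurable_comp (f := fun y => Num.max (G y) (q y)) _ (@X_measurable theta0 x)).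
  by apply: bounded_measurable_max => //; split => //; exists B.
rewrite -meanB//; apply: norm_mean_le_cst => [|w]; first exact: bounded_measurableB.
move: (X theta0 x w) => y.
have bQ := scheme_bounded_measurable n theta0 y.
have bmax : bounded_measurable (fun w => Num.max (G y) (Q n theta0 y w)).
  by apply: bounded_measurable_max => //; exact: bounded_measurable_cst.
rewrite /payoff -[X in _ - X](mean_cst P) -meanB//; last exact: bounded_measurable_cst.
have bd : bounded_measurable (fun w => Num.max (G y) (Q n theta0 y w) - Num.max (G y) (q y)).
  by apply: bounded_measurableB => //; exact: bounded_measurable_cst.
apply: le_trans (norm_mean_le P bd) _.
apply: le_trans (mean_norm_le (bm_err n theta0 y) (u_ge0 n) (cl n (leqnn n) _ _)).
apply: mean_le => [||w']; [exact: bounded_measurable_norm| |exact: max_dist].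
exact/bounded_measurable_norm/bm_err.
Qed.

End error.
End scheme.

(** * The deterministic recursions *)

(** With [a = 1 / sqrt M], the largeness of [M] reads [a (1 + 3 s) < 1 - s],
    hence [s + a + s a < 1]; [kappa] is the midpoint of that gap. *)
Lemma rate_exists (R : realType) (M : nat) (s : R) : 0 <= s -> s < 1 ->
  (1 + 3 * s) ^+ 2 / (1 - s) ^+ 2 < M%:R ->
  exists a kappa : R, [/\ 0 < a, a ^+ 2 = M%:R^-1, a < kappa, kappa < 1 &
    s * (1 + a) <= kappa - a].
Proof.
move=> s0 s1 Ms.
have s1' : 0 < 1 - s by rewrite subr_gt0.
have M0 : 0 < M%:R :> R.
  by apply: le_lt_trans Ms; rewrite divr_ge0// exprn_ge0// ?ltW//; lra.
pose a : R := Num.sqrt M%:R^-1.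
have a0 : 0 < a by rewrite sqrtr_gt0 invr_gt0.
have a2 : a ^+ 2 = M%:R^-1 by rewrite sqr_sqrtr// invr_ge0 ltW.
have small : a * (1 + 3 * s) < 1 - s.
  rewrite -(@ltr_pXn2r _ 2) ?nnegrE//; last 2 first.
  - by rewrite mulr_ge0//; [exact: ltW|lra].
  - exact: ltW.
  rewrite exprMn a2 -[X in X < _]mulrC ltr_pdivrMr// [X in _ < X]mulrC.
  by rewrite -ltr_pdivrMr// exprn_gt0.
exists a, ((s + a + s * a + 1) / 2).
have sa : 0 <= s * a by rewrite mulr_ge0// ltW.
by split => //; nra.
Qed.

(** The sum over the past levels is dominated by a geometric series of ratio
    [a / kappa], hence by a multiple [c] of its last term; the condition on
    [kappa] says that [s (c + 1) <= kappa]. *)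
Lemma geometric_recursion (R : realType) (s a kappa K B delta : R)
    (u : nat -> R) (n : nat) :
  0 < a -> a < kappa -> kappa < 1 -> s * (1 + a) <= kappa - a ->
  0 <= B <= K -> 0 <= delta <= s ->
  (forall l, u l = K * kappa ^+ l) ->
  delta * (\sum_(0 <= l < n.+1) a ^+ (n.+1 - l) *
    (if l is l'.+1 then u l + u l' else B) + u n) <= u n.+1.
Proof.
move=> a0 ak k1 sak /andP[B0 BK] /andP[d0 ds] uE.
pose incr l := if l is l'.+1 then u l + u l' else B.
have k0 : 0 < kappa := lt_trans a0 ak.
have ka : 0 < kappa - a by rewrite subr_gt0.
have K0 : 0 <= K := le_trans B0 BK.
have u0 l : 0 <= u l by rewrite uE mulr_ge0// exprn_ge0// ltW.
(* the constant that is invariant under one step of the sum over the levels *)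
pose c := (1 + kappa) * a / (kappa - a).
have cE : a * c + a * (1 + kappa) = c * kappa.
  by rewrite /c; field; rewrite gt_eqF.
have c0 : 0 <= c by apply: divr_ge0; [apply: mulr_ge0; lra|lra].
have hist m : \sum_(0 <= l < m.+1) a ^+ (m.+1 - l) * incr l <= c * u m.
  elim: m => [|m IH].
    rewrite big_nat1 subn0 expr1 /= uE expr0 mulr1.
    have : a <= c by rewrite /c ler_pdivlMr//; nra.
    nra.
  rewrite big_nat_recr//= subSnn expr1.
  rewrite (_ : \sum_(0 <= l < m.+1) _ =
      a * \sum_(0 <= l < m.+1) a ^+ (m.+1 - l) * incr l); last first.
    rewrite mulr_sumr big_nat [RHS]big_nat; apply: eq_bigr => l /= lm.
    by rewrite subSn 1?ltnW// exprS mulrA.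
  have := ler_wpM2l (ltW a0) IH.
  rewrite (_ : c * u m.+1 = (c * kappa) * u m); last by rewrite !uE exprS; ring.
  rewrite -cE (_ : u m.+1 = kappa * u m); last by rewrite !uE exprS; ring.
  lra.
have sck : s * (c + 1) <= kappa.
  rewrite (_ : c + 1 = kappa * (1 + a) / (kappa - a)); last first.
    by rewrite /c; field; rewrite gt_eqF.
  by rewrite mulrA ler_pdivrMr//; nra.
apply: le_trans (_ : s * (c + 1) * u n <= _); last first.
  by rewrite !uE exprS [leRHS]mulrCA ler_wpM2r// mulr_ge0// exprn_ge0// ltW.
rewrite -mulrA ler_pM//.
  rewrite addr_ge0// sumr_ge0// => l _; rewrite mulr_ge0//; first by rewrite exprn_ge0// ltW.
  by case: l => // l; exact: addr_ge0.
by rewrite mulrDl mul1r lerD2r; exact: hist.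
Qed.

(** Under the bound claimed for smaller levels, the summand [l] is at most
    [3 * 4 ^ l] times [r * M ^ n], and these coefficients sum to [4 ^ n - 1]. *)
Lemma cost_bound (R : realType) (M : nat) (r : R) (C : nat -> R) : (0 < M)%N ->
  0 <= r ->
  (forall n, C n <= \sum_(0 <= l < n)
     M%:R ^+ (n - l) * (r + C l + (0 < l)%N%:R * C l.-1)) ->
  forall n, C n <= r * (4 * M%:R) ^+ n.
Proof.
move=> M0 r0 C_le; have M1 : 1 <= M%:R :> R by rewrite ler1n.
have L1 : 1 <= 4 * M%:R :> R by lra.
elim/ltn_ind => n IH.
have term l : (l < n)%N -> M%:R ^+ (n - l) * (r + C l + (0 < l)%N%:R * C l.-1) <=
    r * M%:R ^+ n * (3 * 4 ^+ l).
  move=> ln; set D := r * (4 * M%:R) ^+ l.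
  have rD : r <= D by rewrite ler_peMr// exprn_ege1.
  have lD : (0 < l)%N%:R * C l.-1 <= D.
    case: l ln @D rD => [|l] ln D rD; first by rewrite mul0r (le_trans r0).
    rewrite mul1r (le_trans (IH l (ltnW ln)))// ler_wpM2l// ler_weXn2l//.
  rewrite (_ : r * M%:R ^+ n * (3 * 4 ^+ l) = M%:R ^+ (n - l) * (3 * D)).
    by rewrite ler_wpM2l ?exprn_ge0//; have := IH l ln; rewrite -/D; lra.
  by rewrite /D exprMn -[in LHS](subnK (ltnW ln)) exprD; ring.
apply: le_trans (C_le n) _; rewrite big_nat.
apply: le_trans (ler_sum _ term) _; rewrite -big_nat -mulr_sumr.
rewrite (_ : \sum_(0 <= l < n) 3 * 4 ^+ l = 4 ^+ n - 1 :> R); last first.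
  elim: n {IH term} => [|n IHn]; first by rewrite big_geq// subrr.
  by rewrite big_nat_recr//= IHn exprS; ring.
rewrite exprMn [4 ^+ n * _]mulrC mulrA ler_wpM2l ?mulr_ge0 ?exprn_ge0//.
by rewrite gerBl.
Qed.

(** The level reached at accuracy [eps] is logarithmic in [1 / eps], so that a
    quantity which is exponential in the level is polynomial in [1 / eps]: the
    exponent [p] is any integer with [L * kappa ^ p <= 1]. *)
Lemma level_selection (R : realType) (K kappa L : R) :
  1 <= K -> 0 < kappa -> kappa < 1 -> 1 <= L ->
  exists (N : R -> nat) (c : R), forall eps, 0 < eps <= 1 ->
    [/\ (0 < N eps)%N, K * kappa ^+ N eps <= eps &
        L ^+ N eps <= c * eps `^ (- c)].
Proof.
move=> K1 k0 k1 L1.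
have K0 : 0 < K by lra.
have cvgk : kappa ^+ n @[n --> \oo] --> (0 : R).
  by apply: cvg_expr; rewrite ger0_norm// ltW.
have small (e : R) : 0 < e -> exists n, kappa ^+ n <= e.
  move=> e0; have /cvgr0Pnorm_lt/(_ _ e0) := cvgk.
  case=> n _ /(_ n (leqnn n))/= h; exists n.
  by rewrite (le_trans (ler_norm _))// ltW.
have [p Lp] : exists p, L * kappa ^+ p <= 1.
  have [|p kp] := small L^-1; first by rewrite invr_gt0; lra.
  by exists p; rewrite mulrC -ler_pdivlMr ?div1r//; lra.
pose c := Num.max p%:R (L * K ^+ p).
have /choice[N NP] : forall eps : R, exists n, 0 < eps <= 1 ->
    [/\ (0 < n)%N, K * kappa ^+ n <= eps & L ^+ n <= c * eps `^ (- c)].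
  move=> eps; have [/andP[e0 e1]|] := boolP (0 < eps <= 1); last by exists 0%N.
  have ex : exists n, (0 < n)%N && (K * kappa ^+ n <= eps).
    have [|n kn] := small (eps / K); first by rewrite divr_gt0.
    exists n.+1; rewrite /= mulrC -ler_pdivlMr// (le_trans _ kn)//.
    by rewrite exprSr ler_piMr ?exprn_ge0 ?ltW.
  case: (ex_minnP ex) => n /andP[n0 Kn] n_min; exists n => _; split => //.
  case: n n0 Kn n_min => // n _ Kn n_min.
  (* minimality of the level, in a form that also covers level one *)
  have prev : eps <= K * kappa ^+ n.
    case: n Kn n_min => [|n] Kn n_min; first by rewrite mulr1; lra.
    rewrite leNgt; apply/negP => h; have := n_min n.+1.
    by rewrite /= (ltW h) => /(_ isT); rewrite ltnn.
  have Ln : L ^+ n <= (K / eps) ^+ p.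
    apply: (le_trans (y := ((kappa ^+ n)^-1) ^+ p)).
      rewrite exprVn -exprM mulnC exprM -exprVn lerXn2r ?nnegrE//.
      - lra.
      - by rewrite invr_ge0 exprn_ge0// ltW.
      by rewrite -[leRHS]div1r ler_pdivlMr// exprn_gt0.
    have kn0 : 0 < kappa ^+ n by rewrite exprn_gt0.
    rewrite lerXn2r ?nnegrE ?invr_ge0 ?divr_ge0 ?(ltW kn0) ?(ltW K0) ?(ltW e0)//.
    by rewrite ler_pdivlMr// ler_pdivrMl// mulrC.
  have powc : (eps ^+ p)^-1 <= eps `^ (- c).
    rewrite powRN lef_pV2 ?posrE ?powR_gt0 ?exprn_gt0//.
    rewrite -powR_mulrn; last exact: ltW.
    by apply: ger_powR; [rewrite e0|rewrite le_max lexx].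
  rewrite exprS; apply: (le_trans (y := L * K ^+ p * (eps ^+ p)^-1)).
    by rewrite -mulrA ler_wpM2l//; [lra|rewrite -expr_div_n].
  rewrite ler_pM//; first by rewrite mulr_ge0 ?exprn_ge0//; lra.
    by rewrite invr_ge0 exprn_ge0// ltW.
  by rewrite le_max lexx orbT.
by exists N, c => eps /NP.
Qed.

(** * The theorem *)

Lemma lt_pinfty_bound (R : realType) (e : \bar R) : (e < +oo)%E ->
  exists B : R, forall r : R, (r%:E <= e)%E -> r <= B.
Proof.
case: e => [r _|//|_]; first by exists r => t; rewrite lee_fin.
by exists 0 => r; rewrite leeNy_eq.
Qed.

(** The extended-real formulation reduces to a real fixed-point equation, since
    bounded integrands have finite means. *)
Lemma bounded_solutionE (R : realType) (d : measure_display)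
    (T : measurableType d) (P : probability T R) (dE : measure_display)
    (E : measurableType dE) (delta : R) (g G : E -> R) (Y : E -> T -> E)
    (q : E -> R) :
  (forall x, measurable_fun [set: T] (Y x)) -> bounded_measurable G ->
  bounded_solution P delta g G Y q <->
  bounded_measurable q /\ q = bellman P Y delta g G q.
Proof.
move=> mY bG.
have bm x : bounded_measurable q ->
    bounded_measurable (fun w => Num.max (G (Y x w)) (q (Y x w))).
  move=> bq; apply: (bounded_measurable_comp (f := fun y => Num.max (G y) (q y)) _ (mY x)).
  exact: bounded_measurable_max.
split => [[mq sol]|[bq qE]].
  have bq : bounded_measurable q.
    split => //; have [/lt_pinfty_bound[B qB] _] := sol point.
    by exists B => x; apply: qB; apply: ereal_sup_ubound; exists x.
  split => //; apply/funext => x; have [_] := sol x.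
  by rewrite mean_fin; [move=> [->]|exact: bm].
split; first exact: bq.1.
move=> x; split.
  have [_ [B qB]] := bq; apply: le_lt_trans (ltry B).
  by apply: ge_ereal_sup => _ [y _ <-]; rewrite lee_fin.
by rewrite mean_fin; [rewrite {1}qE|exact: bm].
Qed.

Theorem corollary4p3 (R : realType) (M : nat) (M_gt0 : (0 < M)%N)
  (dO : measure_display) (Omega : measurableType dO) (P : probability Omega R)
  (D : Type) (D_nonempty : [set: D] !=set0)
  (delta Rc : D -> R)
  (delta_ge0 : forall d, 0 <= delta d) (Rc_ge0 : forall d, 0 <= Rc d)
  (dX : D -> measure_display) (E : forall d : D, measurableType (dX d))
  (E_borel : forall d, borel_space R (E d))
  (g G : forall d : D, E d -> R)
  (g_meas : forall d, measurable_fun [set: E d] (g d))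
  (G_meas : forall d, measurable_fun [set: E d] (G d))
  (F : D -> Theta -> set (set Omega))
  (F_sub : forall d theta, sub_sigma_algebra_of (F d theta))
  (F_indep : forall d, independent_systems P (F d))
  (X : forall d : D, Theta -> E d -> Omega -> E d)
  (X_iid : forall d, iid_random_fields P (X d))
  (X_meas : forall d theta, jointly_measurable (F d theta) (X d theta))
  (sup_delta : (ereal_sup (range (fun d => (delta d)%:E)) < 1)%E)
  (M_large :
    let s := fine (ereal_sup (range (fun d => (delta d)%:E))) in
    M%:R > (1 + 3 * s) ^+ 2 / (1 - s) ^+ 2)
  (gG_bounded :
    (ereal_sup (range (fun d =>
       ereal_sup (range (fun x : E d => (`|g d x| + `|G d x|)%:E)))) < +oo)%E)
  (Q : forall d : D, nat -> Theta -> E d -> Omega -> R)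
  (Q_def : forall d n theta x w,
    Q d n theta x w = g d x +
      \sum_(0 <= l < n)
        delta d / M%:R ^+ (n - l) *
        \sum_(1 <= i < (M ^ (n - l)).+1)
          (let Y := X d (theta_ext theta l%:Z i%:Z) x w in
           Num.max (G d Y) (Q d l (theta_ext theta l%:Z i%:Z) Y w)
           - (0 < l)%N%:R *
             Num.max (G d Y)
               (Q d l.-1 (theta_ext theta (- l%:Z) i%:Z) Y w)))
  (C : nat -> D -> R)
  (C_ge0 : forall n d, 0 <= C n d)
  (C_le : forall n d,
    C n d <= \sum_(0 <= l < n)
      M%:R ^+ (n - l) * (Rc d + C l d + (0 < l)%N%:R * C l.-1 d)) :
  (forall d, exists! q : E d -> R,
     bounded_solution P (delta d) (g d) (G d) (X d theta0) q) /\
  (forall q : forall d : D, E d -> R,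
     (forall d,
       bounded_solution P (delta d) (g d) (G d) (X d theta0) (q d)) ->
     exists (N : R -> nat) (c : R),
       (forall eps, 0 < eps <= 1 -> (0 < N eps)%N) /\
       forall d eps, 0 < eps <= 1 ->
         C (N eps) d <= c * Rc d * eps `^ (- c) /\
         (ereal_sup (range (fun x : E d =>
            'E_P[fun w => (`|q d x - Q d (N eps) theta0 x w| ^+ 2)%R]
              `^ (2^-1)%R)) <= eps%:E)%E).

Proof.
have [d0 _] := D_nonempty.
set sup_d := ereal_sup (range (fun d => (delta d)%:E)) in sup_delta M_large.
have delta_sup d : ((delta d)%:E <= sup_d)%E.
  by apply: ereal_sup_ubound; exists d.
have sup_ge0 : (0 <= sup_d)%E.
  by apply: le_trans (delta_sup d0); rewrite lee_fin.
have sup_fin : sup_d \is a fin_num.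
  by rewrite ge0_fin_numE// (lt_trans sup_delta)// ltry.
pose s := fine sup_d.
have supE : sup_d = s%:E by rewrite fineK.
have s_ge0 : 0 <= s by rewrite -lee_fin -supE.
have s_lt1 : s < 1 by rewrite -lte_fin -supE.
have delta_s d : delta d <= s by rewrite -lee_fin -supE.
have delta_lt1 d : delta d < 1 := le_lt_trans (delta_s d) s_lt1.
have delta01 d : 0 <= delta d <= 1 by rewrite delta_ge0 ltW.
have [B0 B0P] := lt_pinfty_bound gG_bounded.
(* At least 1, so that the initial error bound is at least the accuracy. *)
pose B := Num.max B0 1.
have gGB d (x : E d) : `|g d x| + `|G d x| <= B.
  rewrite le_max; apply/orP; left; apply: B0P.
  apply: le_trans (ereal_sup_ubound _); last by exists d.
  by apply: ereal_sup_ubound; exists x.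
have gB d x : `|g d x| <= B by rewrite (le_trans _ (gGB d x))// lerDl.
have GB d x : `|G d x| <= B by rewrite (le_trans _ (gGB d x))// lerDr.
have B1 : 1 <= B by rewrite le_max lexx orbT.
have bG d : bounded_measurable (G d) by split => //; exists B.
have mX d := X_measurable (F_sub d) (@X_meas d).
have mean_X d (h : E d -> R) : bounded_measurable h ->
    bounded_measurable (fun x => mean P (fun w => h (X d theta0 x w))).
  move=> bh; apply: (bounded_measurable_mean_field (S := [set theta0])
    (f := fun x w => h (X d theta0 x w)) P (F_sub d)).
  exact: bounded_measurable_comp bh (@X_field _ _ _ _ _ _ (@X_meas d) theta0).
have solE d q := bounded_solutionE P (delta d) (g d) q (mX d theta0) (bG d).
split=> [d|q q_sol].
  have [q bq qE] := bellman_fixed_exists (mX d theta0) (@mean_X d) (delta_ge0 d)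
    (delta_lt1 d) (g_meas d) (G_meas d) (gB d) (GB d).
  exists q; split; first by apply/solE.
  move=> q' /solE[bq' qE'].
  exact: (bellman_fixed_unique (mX d theta0) (delta_ge0 d) (delta_lt1 d)
    (G_meas d) (GB d) bq bq' qE qE').
have [a [kappa [a0 a2 ak k1 sak]]] := rate_exists s_ge0 s_lt1 M_large.
have k0 : 0 < kappa := lt_trans a0 ak.
(* The error of level zero: [g] is bounded by [B], the fixed point by the rest. *)
pose K := B + (B + B) / (1 - s).
have K_B : B <= K by rewrite lerDl divr_ge0// ?subr_ge0 ?ltW//; lra.
have K1 : 1 <= K := le_trans B1 K_B.
pose u l := K * kappa ^+ l.
have u_ge0 l : 0 <= u l by rewrite mulr_ge0 ?exprn_ge0 ?ltW//; lra.
have conv d n : accurate P (Q d) (q d) u n.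
  have [bq qE] := (solE d (q d)).1 (q_sol d).
  elim/ltn_ind: n => -[_ theta y|n IH theta y].
    have q_bound x : `|q d x| <= (B + B) / (1 - s).
      have := bellman_fixed_bound (mX d theta0) (delta_ge0 d) (delta_lt1 d)
        (G_meas d) (gB d) (GB d) bq qE x.
      move/le_trans; apply; rewrite ler_pM2l ?lef_pV2 ?posrE ?subr_gt0//; last lra.
      by rewrite lerD2l lerN2.
    under eq_fun do rewrite (scheme0 (Q_def d)).
    rewrite mean_cst /u expr0 mulr1 -[leLHS]real_normK ?num_real// lerXn2r ?nnegrE//.
      by lra.
    by rewrite (le_trans (ler_normB _ _))// lerD.
  have q_fix x : q d x = g d x + delta d *
      mean P (fun w => Num.max (G d (X d theta0 x w)) (q d (X d theta0 x w))).
    by rewrite {1}qE.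
  have step := error_step M_gt0 (F_sub d) (F_indep d) (X_iid d) (@X_meas d)
    (delta01 d) (g_meas d) (G_meas d) (gB d) (GB d) (Q_def d) bq q_fix u_ge0
    (ltW a0) a2 (n := n) (fun l ln => IH l ln) theta y.
  apply: le_trans step _; rewrite lerXn2r ?nnegrE//.
    rewrite mulr_ge0 ?addr_ge0 ?sumr_ge0// => l _.
    rewrite mulr_ge0 ?exprn_ge0 ?(ltW a0)//.
    exact: (increment_ge0 (gB d) u_ge0).
  apply: (geometric_recursion (s := s) (kappa := kappa) (K := K)) => //.
    by rewrite K_B; lra.
  by rewrite delta_ge0 delta_s.
have M1 : 1 <= M%:R :> R by rewrite ler1n.
have L1 : 1 <= 4 * M%:R :> R by lra.
have [N [c Nc]] := level_selection K1 k0 k1 L1.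
exists N, c; split=> [eps /Nc[]//|d eps eps01].
have [N0 KN LN] := Nc eps eps01.
have eps0 : 0 < eps by case/andP: eps01.
split.
  apply: le_trans (cost_bound M_gt0 (Rc_ge0 d) (fun n => C_le n d) (N eps)) _.
  by rewrite [leRHS]mulrAC [leRHS]mulrC ler_wpM2l.
have [bq _] := (solE d (q d)).1 (q_sol d).
apply: ge_ereal_sup => _ [x _ <-].
have be : bounded_measurable (fun w => q d x - Q d (N eps) theta0 x w).
  apply: bounded_measurableB; first exact: bounded_measurable_cst.
  exact: (scheme_bounded_measurable M_gt0 (F_sub d) (@X_meas d)
    (delta01 d) (g_meas d) (G_meas d) (gB d) (GB d) (Q_def d)).
rewrite mean_fin; last exact/bounded_measurable_sqr/bounded_measurable_norm.
rewrite poweR_EFin lee_fin powR12_sqrt; last by apply: mean_ge0 => w; exact: sqr_ge0.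
rewrite -[leRHS]ger0_norm ?(ltW eps0)// -sqrtr_sqr ler_wsqrtr//.
apply: le_trans (_ : u (N eps) ^+ 2 <= _); last by rewrite lerXn2r ?nnegrE// ltW.
rewrite (_ : (fun w => _) = fun w => (Q d (N eps) theta0 x w - q d x) ^+ 2).
  exact: conv.
by apply/funext => w; rewrite real_normK ?num_real// -sqrrN opprB.
Qed.
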